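(* Let $G$ be a virtually free finitely generated group. Then every Cayley graph of $G$ is LG-rigid.
   Context: A ''graph'' means a connected, locally finite graph without loops or multiple edges, equipped with the geodesic metric giving each edge length $1$; ''$x\in X$'' means that $x$ is a vertex of $X$; balls are closed balls. A covering from a graph $X$ to a graph $Y$ is a graph covering map (a surjective graph morphism which, for every vertex $x$, maps the neighbors of $x$ bijectively onto the neighbors of its image); $Y$ is covered by $X$ if such a map $X\to Y$ exists. Given a finitely generated group $G$ and a finite symmetric generating set $S$, the Cayley graph $(G,S)$ is the graph with vertex set $G$ and distance $d(g,h)=|g^{-1}h|_S$ (word length). Given a graph $X$ and $R>0$, a graph $Y$ is $R$-locally $X$ if for every vertex $y\in Y$ there exists $x\in X$ such that the balls $B_X(x,R)$ and $B_Y(y,R)$, equipped with their intrinsic geodesic metrics, are isometric. $X$ is LG-rigid at scale $R$ if every graph which is $R$-locally $X$ is covered by $X$. $X$ is LG-rigid if it is LG-rigid at scale $R$ for some $R>0$. *)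

(* Defs.v *)
From mathcomp Require Import all_boot all_order all_algebra.
From mathcomp Require Import boolp classical_sets functions cardinality reals.

Set Implicit Arguments.
Unset Strict Implicit.
Unset Printing Implicit Defensive.

Import Order.TTheory GRing.Theory Num.Theory.

Local Open Scope classical_set_scope.
Local Open Scope ring_scope.

(* Absence of multiple edges is built in: edges are given by a relation.  A   *)
(* connected graph is understood to be nonempty.                              *)
Record graph := Graph {
  vertex :> Type;
  adj : rel vertex;
  adj_sym : symmetric adj;
  adj_irr : irreflexive adj;
  graph_nonempty : [set: vertex] !=set0;
  graph_connected : forall x y, exists2 w : seq vertex, path adj x w & last x w = y;
  graph_locally_finite : forall x, finite_set [set y | adj x y]
}.

Definition is_covering (X Y : graph) (f : X -> Y) : Prop :=
  [/\ set_surj [set: X] [set: Y] f,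
      {homo f : x x' / adj x x'}
    & forall x, set_bij [set x' | adj x x'] [set y' | adj (f x) y'] f].

Definition covered_by (Y X : graph) : Prop := exists f : X -> Y, is_covering f.

Section Metric.
Variable R : realType.

(* A point of the geometric realization of a graph is encoded by its          *)
(* barycentric coordinates: a function from the vertices to R, supported on a *)
(* vertex or on an edge.  [epoint u v t] is the point of the edge uv at       *)
(* distance t from u and 1 - t from v; in particular                          *)
(* [epoint u v 0 = vpoint u] and [epoint u v t = epoint v u (1 - t)].         *)
Definition vpoint (X : graph) (v : X) : X -> R := fun w => `[< w = v >]%:R.

Definition epoint (X : graph) (u v : X) (t : R) : X -> R :=
  fun w => (1 - t) * vpoint u w + t * vpoint v w.

Definition realization (X : graph) : set (X -> R) :=
  [set p | (exists v, p = vpoint v) \/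
           (exists u v (t : R), [/\ adj u v, 0 <= t <= 1 & p = epoint u v t])].

(* [plpath B p q L]: a piecewise linear path of length L goes from p to q in  *)
(* the subset B; every linear piece runs along a single edge of length 1.     *)
Inductive plpath (X : graph) (B : set (X -> R)) : (X -> R) -> (X -> R) -> R -> Prop :=
| plpath_nil p : B p -> plpath B p p 0
| plpath_cons u v (s t : R) q L :
    adj u v -> 0 <= s <= 1 -> 0 <= t <= 1 ->
    (forall r, Num.min s t <= r <= Num.max s t -> B (epoint u v r)) ->
    plpath B (epoint u v t) q L ->
    plpath B (epoint u v s) q (`|s - t| + L).

(* Intrinsic (length) metric of a path-connected subset B.                    *)
Definition intrinsic_dist (X : graph) (B : set (X -> R)) (p q : X -> R) : R :=
  inf [set L | plpath B p q L].

Definition geodesic_dist (X : graph) (p q : X -> R) : R :=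
  intrinsic_dist (@realization X) p q.

Definition closed_ball (X : graph) (x : X) (r : R) : set (X -> R) :=
  [set p | @realization X p /\ geodesic_dist (vpoint x) p <= r].

Definition isometric_subsets (X Y : graph) (A : set (X -> R)) (B : set (Y -> R)) : Prop :=
  exists2 f : (X -> R) -> (Y -> R), set_bij A B f &
    forall p q, A p -> A q -> intrinsic_dist B (f p) (f q) = intrinsic_dist A p q.

(* The isometries are not required to preserve the centers of the balls.      *)
Definition locally_at (r : R) (X Y : graph) : Prop :=
  forall y : Y, exists x : X, isometric_subsets (closed_ball x r) (closed_ball y r).

Definition LG_rigid_at (r : R) (X : graph) : Prop :=
  forall Y : graph, locally_at r X Y -> covered_by Y X.

Definition LG_rigid (X : graph) : Prop := exists2 r : R, 0 < r & LG_rigid_at r X.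

End Metric.

Section Groups.
Local Open Scope group_scope.
Variable G : groupType.

Definition is_subgroup (H : set G) : Prop :=
  [/\ H 1, forall x y, H x -> H y -> H (x * y) & forall x, H x -> H x^-1].

Definition generates (S : set G) : Prop :=
  forall H : set G, is_subgroup H -> S `<=` H -> H = [set: G].

Definition finitely_generated : Prop := exists2 S : set G, finite_set S & generates S.

(* The letter (b, false) stands for b and (b, true) for its inverse.          *)
Definition letter_val (a : G * bool) : G := if a.2 then a.1^-1 else a.1.

Definition word_val (w : seq (G * bool)) : G := \prod_(a <- w) letter_val a.

Definition reduced (w : seq (G * bool)) : bool :=
  sorted (fun a b => ~~ ((a.1 == b.1) && (a.2 != b.2))) w.

(* The subgroup H is free with basis B: every element of H is represented by  *)
(* a unique reduced word in B and its inverses.                               *)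
Definition free_on (H B : set G) : Prop :=
  B `<=` H /\
  forall h, H h -> exists! w : seq (G * bool),
    [/\ forall a : G * bool, a \in w -> B a.1, reduced w & word_val w = h].

Definition finite_index (H : set G) : Prop :=
  finite_set [set C : set G | exists g, C = [set h * g | h in H]].

Definition virtually_free : Prop :=
  exists H : set G,
    [/\ is_subgroup H, finite_index H & exists B : set G, free_on H B].

Definition finite_symmetric_generating (S : set G) : Prop :=
  [/\ finite_set S, forall s, S s -> S s^-1 & generates S].

Definition expresses (S : set G) (w : seq G) (g : G) : Prop :=
  (forall s, s \in w -> S s) /\ \prod_(s <- w) s = g.

(* The word length of g with respect to S is n.                               *)
Definition has_word_length (S : set G) (g : G) (n : nat) : Prop :=
  (exists2 w, expresses S w g & size w = n) /\
  (forall w, expresses S w g -> (n <= size w)%N).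

(* Edges join the elements at word distance 1; the identity may belong to S.  *)
Definition cayley_adj (S : set G) : rel G :=
  fun g h => `[< has_word_length S (g^-1 * h) 1%N >].

Lemma cayley_adjE S g h : cayley_adj S g h <-> g <> h /\ S (g^-1 * h).
Proof.
rewrite /cayley_adj asboolE; split.
  case=> -[w [wS wP] w1] min; split.
    move=> gh; have /min : expresses S [::] (g^-1 * h).
      by split=> //; rewrite big_nil gh mulVg.
    by [].
  case: w w1 wS wP => [|s [|]] // _ wS; rewrite big_seq1 => <-.
  by apply: wS; rewrite mem_head.
case=> gh Sgh; split.
  by exists [:: g^-1 * h] => //; split; [move=> s /[!inE] /eqP->|rewrite big_seq1].
case=> [|//] [_]; rewrite big_nil => e; case: gh.
by apply: (mulgI g^-1); rewrite -e mulVg.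
Qed.

Section Cayley.
Variables (S : set G) (hS : finite_symmetric_generating S).

Lemma cayley_sym : symmetric (cayley_adj S).
Proof.
suff h g k : cayley_adj S g k -> cayley_adj S k g by move=> g k; apply/idP/idP; apply: h.
move=> /cayley_adjE[gk Sgk]; apply/cayley_adjE; split; first exact: nesym.
by case: hS => _ /(_ _ Sgk) + _; rewrite invgM invgK.
Qed.

Lemma cayley_irr : irreflexive (cayley_adj S).
Proof. by move=> g; apply/negP => /cayley_adjE[]. Qed.

Lemma cayley_nonempty : [set: G] !=set0. Proof. by exists 1. Qed.

Lemma cayley_connected g h :
  exists2 w : seq G, path (cayley_adj S) g w & last g w = h.
Proof.
pose H := [set k | forall g, exists2 w : seq G,
  path (cayley_adj S) g w & last g w = g * k].
suff: H = [set: G].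
  move=> HT; have : H (g^-1 * h) by rewrite HT.
  by move=> /(_ g)[w pw lw]; exists w => //; rewrite lw mulVKg.
case: hS => _ _; apply.
  split=> [x|x y Hx Hy z|x Hx z].
  - by exists [::] => //; rewrite mulg1.
  - have [w pw lw] := Hx z; have [w' pw' lw'] := Hy (z * x).
    by exists (w ++ w'); rewrite ?cat_path ?last_cat ?pw ?lw ?lw' ?mulgA.
  - have [w pw lw] := Hx (z * x^-1).
    exists (rev (belast (z * x^-1) w)); last first.
      case: w {pw} lw => [/=|a w _] /=; first by rewrite mulgVK.
      by rewrite rev_cons last_rcons.
    have Ez : last (z * x^-1) w = z by rewrite lw mulgVK.
    rewrite -[X in path _ X]Ez rev_path -(eq_path (e := cayley_adj S)) // => a b.
    exact: cayley_sym.
move=> s Ss x; have [xs|xs] := pselect (x = x * s).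
  by exists [::].
exists [:: x * s] => //=; rewrite andbT; apply/cayley_adjE.
by rewrite mulKg.
Qed.

Lemma cayley_locally_finite g : finite_set [set h | cayley_adj S g h].
Proof.
case: hS => fS _ _; apply: (@sub_finite_set _ _ [set g * s | s in S]).
  by move=> h /= /cayley_adjE[_ Sh]; exists (g^-1 * h) => //; rewrite mulVKg.
exact: finite_image.
Qed.

Definition cayley_graph : graph :=
  Graph cayley_sym cayley_irr cayley_nonempty cayley_connected cayley_locally_finite.

End Cayley.
End Groups.

(* Main.v *)
Require Import Defs.
From mathcomp Require Import all_boot all_order all_algebra.
From mathcomp Require Import boolp classical_sets functions cardinality reals.
From mathcomp Require Import filter lra ring zify.

(* Suppose first that the vertices of the Cayley graph X have degree at least 3,
   and take a large half-integer radius.  Isometries between balls preserve branch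
   points, hence vertices, so every y in Y comes with an isomorphism of
   combinatorial balls centered at y.  By compactness, an isomorphism on a large
   ball agrees on a smaller ball with a global automorphism of X; hence a ball
   isomorphism f at a vertex a of X can be replaced, at a vertex b near a, by a ball
   isomorphism of the same radius that agrees with f near b.  Performing these
   replacements along the reduced words of a free subgroup H of finite index yields
   one ball isomorphism for each h in H, and because reduced words form a tree, those
   at neighbouring elements of H agree.  Reading off the value at x from the one
   attached to the H-component of x gives the covering.

   In degree at most 2 isometries need not preserve vertices.  If X is a line, balls
   of radius 1/2 show that Y is 2-regular, and walking along Y covers it.  If X is a
   cycle, the isometry carries a rotated copy of the vertex set of X to vertices of Y. *)

Set Implicit Arguments.
Unset Strict Implicit.
Unset Printing Implicit Defensive.

Import Order.TTheory GRing.Theory Num.Theory.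

Local Open Scope classical_set_scope.

(** * Combinatorial balls and ball isomorphisms *)

Section FiniteSets.

Lemma finite_uniform_bound (T : Type) (A : set T) (P : T -> nat -> Prop) :
  finite_set A ->
  (forall a m n, m <= n -> P a m -> P a n)%N ->
  (forall a, A a -> exists n, P a n) -> exists n, forall a, A a -> P a n.
Proof.
move=> fA Pmono; have [s ->] := (@finite_seqP {classic T} A).1 fA.
elim: s => [|a s IHs] sP; first by exists 0%N.
have [|n nP] := IHs; first by move=> b bs; apply: sP; rewrite /= inE bs orbT.
have [|m mP] := sP a; first by rewrite /= mem_head.
exists (maxn m n) => b; rewrite /= inE => /orP[/eqP->|bs].
  exact: Pmono (leq_maxl _ _) mP.
exact: Pmono (leq_maxr _ _) (nP _ bs).
Qed.

Lemma ultra_finite_choice (I T : Type) (U : set_system I) (A : set T) (t : I -> T) :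
  UltraFilter U -> finite_set A -> U [set i | A (t i)] ->
  exists2 a, A a & U [set i | t i = a].
Proof.
move=> UU fA; have [s ->] := (@finite_seqP {classic T} A).1 fA => {fA}.
elim: s => [|a s IHs] Us.
  have [] := @filter_not_empty _ U _.
  by apply: filterS Us => i.
have [Ua|Ua] := in_ultra_setVsetC [set i | t i = a] UU.
  by exists a => //=; rewrite mem_head.
have [|b bs Ub] := IHs.
  apply: filterS2 Us Ua => i; rewrite /= inE => /orP[/eqP //|//].
by exists b => //=; rewrite inE; apply/orP; right.
Qed.

Lemma finite_inj_surj (T : Type) (A : set T) (g : T -> T) :
  finite_set A -> set_fun A A g -> set_inj A g -> A `<=` g @` A.
Proof.
move=> fA gA ginj.
have [s As] := (@finite_seqP {classic T} A).1 fA.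
pose u : seq {classic T} := undup s; pose h : {classic T} -> {classic T} := g.
have Au x : A x <-> (x : {classic T}) \in u by rewrite mem_undup As.
have uh : uniq (map h u).
  rewrite map_inj_in_uniq ?undup_uniq // => y z /Au Ay /Au Az.
  by apply: ginj; rewrite inE.
have hu : {subset map h u <= u} by move=> _ /mapP[y /Au Ay ->]; apply/Au/gA.
have [|_ uE] := uniq_min_size uh hu; first by rewrite size_map.
by move=> x /Au; rewrite -uE => /mapP[y /Au Ay ->]; exists y.
Qed.

End FiniteSets.

Section CombinatorialBalls.
Variable X : graph.
Implicit Types (a b x y : X).

(** Radii grow at the outer end, so induction on [n] adds the last edge of a path leaving [a]. This
    is the discrete counterpart of the metric balls. *)
Fixpoint cball (n : nat) (a : X) : set X :=
  if n is m.+1 then [set y | cball m a y \/ exists2 x, cball m a x & adj x y]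
  else [set a].

Lemma cball_center n a : cball n a a.
Proof. by elim: n => //= n IHn; left. Qed.

Lemma cball_mono m n a x : (m <= n)%N -> cball m a x -> cball n a x.
Proof.
move=> /subnK <-; elim: (n - m)%N => //= k IHk ax.
by left; apply: IHk.
Qed.

Lemma cball_step n a x y : cball n a x -> adj x y -> cball n.+1 a y.
Proof. by move=> ax xy; right; exists x. Qed.

Lemma cball1 x y : adj x y -> cball 1 x y.
Proof. exact: (@cball_step 0). Qed.

Lemma cball_trans m n a b x : cball m a b -> cball n b x -> cball (m + n) a x.
Proof.
move=> ab; elim: n x => [|n IHn] x; first by rewrite addn0 => ->.
rewrite addnS => -[bx|[z bz zx]]; first by left; apply: IHn.
by right; exists z => //; apply: IHn.
Qed.

Lemma cball_sym n a b : cball n a b -> cball n b a.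
Proof.
elim: n b => [|n IHn] b; first by move=> ->.
case=> [ab|[z az zb]]; first by left; apply: IHn.
rewrite -add1n; apply: cball_trans (IHn _ az).
by apply: cball1; rewrite adj_sym.
Qed.

Lemma cball_exhaust a x : exists n, cball n a x.
Proof.
have [w aw <-] := graph_connected a x.
exists (size w); elim: w a aw => //= y w IHw a /andP[ay yw].
exact: (cball_trans (cball1 ay) (IHw _ yw)).
Qed.

Lemma finite_cball n a : finite_set (cball n a).
Proof.
elim: n => [|n IHn]; first exact: finite_set1.
rewrite (_ : cball n.+1 a =
    cball n a `|` \bigcup_(x in cball n a) [set y | adj x y]); last first.
  apply/seteqP; split=> y /=.
    by case=> [|[x]]; [left|right; exists x].
  by case=> [|[x]]; [left|right; exists x].
rewrite finite_setU; split=> //; apply: bigcup_finite => // x _.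
exact: graph_locally_finite.
Qed.

Lemma graph_ind (P : X -> Prop) a :
  P a -> (forall x y, P x -> adj x y -> P y) -> forall x, P x.
Proof.
move=> Pa PS x; have [w aw <-] := graph_connected a x.
elim: w a Pa aw => //= y w IHw a Pa /andP[ay yw]; exact: IHw (PS _ _ Pa ay) yw.
Qed.

End CombinatorialBalls.

(** Surjectivity comes for free: the image is nonempty and closed under adjacency, and [Y] is
    connected. *)
Lemma local_iso_covering (X Y : graph) (f : X -> Y) :
  (forall x x', adj x x' -> adj (f x) (f x')) ->
  (forall x x1 x2, adj x x1 -> adj x x2 -> f x1 = f x2 -> x1 = x2) ->
  (forall x y, adj (f x) y -> exists2 x', adj x x' & f x' = y) ->
  is_covering f.
Proof.
move=> fadj finj fsurj; split => //.
- have [x0 _] := graph_nonempty X.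
  move=> y _; apply: (@graph_ind Y _ (f x0)) y; first by exists x0.
  by move=> _ y [x _ <-] /fsurj[x' _ <-]; exists x'.
- move=> x; split.
  + by move=> x' /= /fadj.
  + by move=> x1 x2; rewrite !inE; apply: finj.
  + by move=> y /= /fsurj[x' xx' <-]; exists x'.
Qed.

Section BallIsomorphisms.

(* Adjacency between two vertices at distance exactly [r] from [a] is not controlled. *)
Definition ball_iso (X Y : graph) (r : nat) (a : X) (f : X -> Y) : Prop :=
  set_inj (cball r a) f /\
  forall j x, (j < r)%N -> cball j a x ->
    (forall x', adj x x' -> adj (f x) (f x')) /\
    (forall y, adj (f x) y -> exists2 x', adj x x' & f x' = y).

Variables X Y Z : graph.

Lemma ball_iso_image r (a : X) (f : X -> Y) j x :
  ball_iso r a f -> (j <= r)%N -> cball j a x -> cball j (f a) (f x).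
Proof.
move=> [_ fS]; elim: j x => [|j IHj] x jr; first by move=> ->.
case=> [ax|[z az zx]]; first by left; apply: IHj => //; apply: ltnW.
right; exists (f z); first by apply: IHj => //; apply: ltnW.
exact: (fS j z jr az).1.
Qed.

Lemma ball_iso_preimage r (a : X) (f : X -> Y) j y :
  ball_iso r a f -> (j <= r)%N -> cball j (f a) y -> exists2 x, cball j a x & f x = y.
Proof.
move=> [_ fS]; elim: j y => [|j IHj] y jr; first by move=> ->; exists a.
case=> [ay|[z az zy]].
  by have [x ax <-] := IHj _ (ltnW jr) ay; exists x => //; left.
have [x ax xz] := IHj _ (ltnW jr) az; rewrite -xz in zy.
have [x' xx' <-] := (fS j x jr ax).2 _ zy.
by exists x' => //; right; exists x.
Qed.

Lemma ball_iso_shrink r r' (a b : X) (f : X -> Y) j :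
  ball_iso r a f -> cball j a b -> (j + r' <= r)%N -> ball_iso r' b f.
Proof.
move=> [finj fS] ab jr; split.
  move=> x x' /set_mem bx /set_mem bx'; apply: finj; apply/mem_set.
    exact: cball_mono jr (cball_trans ab bx).
  exact: cball_mono jr (cball_trans ab bx').
move=> i x ir bx; apply: (fS (j + i)%N); last exact: cball_trans bx.
by rewrite (leq_trans _ jr) // ltn_add2l.
Qed.

Lemma ball_iso_mono r r' (a : X) (f : X -> Y) :
  (r' <= r)%N -> ball_iso r a f -> ball_iso r' a f.
Proof. by move=> rr fi; apply: (@ball_iso_shrink r r' a a f 0%N). Qed.

Lemma ball_iso_comp r (a : X) (f : X -> Y) (g : Y -> Z) :
  ball_iso r a f -> ball_iso r (f a) g -> ball_iso r a (g \o f).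
Proof.
move=> fi gi; have [finj fS] := fi; have [ginj gS] := gi; split.
  move=> x x' ax ax' /ginj e; apply: finj => //; apply: e; apply/mem_set.
    by apply: ball_iso_image fi _ _ => //; apply/set_mem.
  by apply: ball_iso_image fi _ _ => //; apply/set_mem.
move=> j x jr ax.
have [gS1 gS2] := gS j (f x) jr (ball_iso_image fi (ltnW jr) ax).
have [fS1 fS2] := fS j x jr ax.
split; first by move=> x' /fS1 /gS1.
by move=> z /gS2[y /fS2[x' xx' <-] <-]; exists x'.
Qed.

End BallIsomorphisms.

Section BallIsomorphismExtension.
Variables X Y : graph.

(** [alpha] is [g^-1] after [f]: both maps carry the ball about [b] onto the same ball of [Y]. *)
Lemma ball_iso_lift r (b : X) (f g : X -> Y) :
  ball_iso r b f -> ball_iso r b g -> f b = g b ->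
  exists alpha : X -> X, [/\ alpha b = b, ball_iso r b alpha
    & forall x, cball r b x -> g (alpha x) = f x].
Proof.
move=> fi gi fgb; have [finj fS] := fi; have [ginj gS] := gi.
(* One preimage serves all radii [j] at once: injectivity of [g] on the large ball identifies it
   with the preimage found in each smaller ball. *)
have /choice[al alP] : forall x, exists x', forall j, (j <= r)%N -> cball j b x ->
    cball j b x' /\ g x' = f x.
  move=> x; have [rx|nrx] := pselect (cball r b x); last first.
    by exists x => j jr jx; case: nrx; apply: cball_mono jr jx.
  have [|x' rx' e] := @ball_iso_preimage _ _ r b g r (f x) gi (leqnn _).
    by rewrite -fgb; apply: ball_iso_image fi _ _.
  exists x' => j jr jx; split => //.
  have [|z jz ez] := @ball_iso_preimage _ _ r b g j (f x) gi jr.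
    by rewrite -fgb; apply: ball_iso_image fi _ _.
  rewrite (_ : x' = z) //; apply: ginj; rewrite ?e //; apply/mem_set => //.
  exact: cball_mono jr jz.
have alE x : cball r b x -> g (al x) = f x by move=> /(alP _ _ (leqnn _))[].
have alC j x : (j <= r)%N -> cball j b x -> cball j b (al x).
  by move=> jr /(alP _ _ jr)[].
exists al; split => //.
- by have := alC 0%N b; apply.
split.
  move=> x x' /set_mem rx /set_mem rx' e; apply: finj; try exact/mem_set.
  by rewrite -!alE // e.
move=> j x jr jx.
have rx : cball r b x by apply: cball_mono (ltnW jr) jx.
have jax : cball j b (al x) by apply: alC (ltnW jr) jx.
have rN x' z : cball j b z -> adj z x' -> cball r b x'.
  by move=> jz zx'; apply: cball_mono jr _; apply: cball_step zx'.
split=> x' xx'.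
  have rx' : cball r b x' by apply: rN xx'.
  have := (fS j x jr jx).1 _ xx'; rewrite -!alE // => /(gS j (al x) jr jax).2.
  move=> [z xz ez]; rewrite (_ : al x' = z) //; apply: ginj; rewrite ?ez //.
    by apply/mem_set; apply: alC.
  by apply/mem_set; apply: rN xz.
have := (gS j (al x) jr jax).1 _ xx'; rewrite alE // => /(fS j x jr jx).2[z xz ez].
have rz : cball r b z by apply: rN xz.
exists z => //; apply: ginj; rewrite ?alE ?ez //; apply/mem_set; first exact: alC.
exact: rN xx'.
Qed.

(* Balls are finite, so an ultrafilter on the radii turns a sequence of partial
   isomorphisms into a global one agreeing with infinitely many of them. *)
Lemma ball_iso_compactness (b : X) (k : nat) :
  exists r, forall alpha : X -> X, alpha b = b -> ball_iso r b alpha ->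
    exists g : X -> X, [/\ g b = b, forall n, ball_iso n b g
      & forall x, cball k b x -> g x = alpha x].
Proof.
apply: contrapT => H.
(* If no radius works, each [n] has a bad isomorphism [al n]; a limit of these will contradict the
   choice of one of them. *)
have {H} /choice[al alP] : forall n, exists alpha : X -> X,
    [/\ alpha b = b, ball_iso n b alpha & forall g : X -> X, g b = b ->
      (forall n, ball_iso n b g) -> ~ forall x, cball k b x -> g x = alpha x].
  move=> n; apply: contrapT => Hn; apply: H; exists n => alpha ab ai.
  apply: contrapT => Hg; apply: Hn; exists alpha; split=> // g gb gi gk.
  by apply: Hg; exists g.
have [U [UU evU]] := ultraFilterLemma eventually_filter.
have Uge n : U [set m | (n <= m)%N] by apply: evU; exists n.
have alC m j x : (j <= m)%N -> cball j b x -> cball j b (al m x).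
  by move=> jm jx; have [ab ai _] := alP m; rewrite -{1}ab; apply: ball_iso_image ai _ _.
(* The limit: [al m x] stays in a finite ball about [b], hence is constant on a set of indices in
   [U]. *)
have /choice[g gP] : forall x, exists y, U [set m | al m x = y].
  move=> x; have [j jx] := cball_exhaust b x.
  have [||y _ Uy] := @ultra_finite_choice _ _ U (cball j b) (fun m => al m x) UU.
  - exact: finite_cball.
  - by apply: filterS (Uge j) => m jm; apply: alC.
  by exists y.
have gD x y : U [set m | al m x = y] -> g x = y.
  move=> Uy; have [m [<- <-]] := filter_ex (filterI (gP x) Uy).
  by [].
have gb : g b = b.
  by apply: gD; apply: filterS (Uge 0%N) => m _; have [] := alP m.
have gi n : ball_iso n b g.
  split.
    move=> x x' /set_mem nx /set_mem nx' e.
    have [m [[mx mx'] nm]] := filter_ex (filterI (filterI (gP x) (gP x')) (Uge n)).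
    have [_ [minj _] _] := alP m; apply: minj; rewrite ?mx ?mx' //.
      by apply/mem_set; apply: cball_mono nx.
    by apply/mem_set; apply: cball_mono nx'.
  move=> j x jn jx; split=> x' xx'.
    have [m [[mx mx'] nm]] := filter_ex (filterI (filterI (gP x) (gP x')) (Uge n)).
    have [_ [_ mS] _] := alP m.
    by rewrite -mx -mx'; apply: (mS j x _ jx).1 => //; apply: leq_trans nm.
  (* The preimages of [x'] under the maps [al m] lie among the finitely many neighbours of [x], so
     one of them serves for [U]-many [m]. *)
  have /choice[z zP] : forall m, exists z, al m x = g x -> (n <= m)%N ->
      adj x z /\ al m z = x'.
    move=> m; have [[mx nm]|H] := pselect (al m x = g x /\ (n <= m)%N); last first.
      by exists x => mx nm; case: H.
    have [_ [_ mS] _] := alP m.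
    have [|z xz ez] := (mS j x (leq_trans jn nm) jx).2 x'; first by rewrite mx.
    by exists z.
  have [||z0 xz0 Uz0] := @ultra_finite_choice _ _ U [set z | adj x z] z UU.
  - exact: graph_locally_finite.
  - by apply: filterS (filterI (gP x) (Uge n)) => m [mx nm]; have [] := zP m mx nm.
  exists z0 => //; apply: gD.
  apply: filterS (filterI (filterI (gP x) (Uge n)) Uz0) => m [[mx nm] /= <-].
  by have [] := zP m mx nm.
(* The ball of radius [k] is finite, so [U] contains a set of indices on which all its points have
   reached their limit values. *)
have [m mk] : exists m, forall x, cball k b x -> g x = al m x.
  suff : U [set m | forall x, cball k b x -> al m x = g x].
    by move=> /filter_ex[m mP]; exists m => x /mP.
  have [s sE] := (@finite_seqP {classic X} (cball k b)).1 (finite_cball k b).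
  rewrite sE; elim: s {sE} => [|x s IHs].
    by apply: filterS (Uge 0%N) => m _ x.
  apply: filterS (filterI IHs (gP x)) => m [ms mx] y /=.
  by rewrite inE => /orP[/eqP->//|]; apply: ms.
by have [_ _ H] := alP m; apply: H mk.
Qed.

End BallIsomorphismExtension.

(** * Gluing over a virtually free group *)

Section CayleyTranslations.
Local Open Scope group_scope.
Variables (G : groupType) (S : set G) (hS : finite_symmetric_generating S).
Let X := cayley_graph hS.

Lemma adj_mull (g : G) (x y : X) : adj (g * x : X) (g * y : X) = adj x y.
Proof.
have E : (g * x)^-1 * (g * y) = x^-1 * y by rewrite invgM -mulgA mulKg.
by rewrite /= /cayley_adj E.
Qed.

Lemma cball_mull n (g : G) (a x : X) : cball n a x -> cball n (g * a : X) (g * x : X).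
Proof.
elim: n x => [|n IHn] x; first by move=> ->.
case=> [/IHn|[z /IHn gz zx]]; first by left.
by right; exists (g * z) => //; rewrite adj_mull.
Qed.

Lemma cball_cayleyE n (a x : X) : cball n a x <-> cball n (1 : X) (a^-1 * x : X).
Proof.
split=> [/(cball_mull a^-1)|/(cball_mull a)]; first by rewrite mulVg.
by rewrite mulg1 mulVKg.
Qed.

Lemma ball_iso_mull n (g : G) (a : X) : ball_iso n a (fun x : X => g * x : X).
Proof.
split; first by move=> x y _ _ /mulgI.
move=> j x _ _; split=> [x' xx'|y gxy]; first by rewrite adj_mull.
by exists (g^-1 * y); rewrite ?mulVKg // -(adj_mull g) mulVKg.
Qed.

Lemma ball_iso_mull_dom (Y : graph) n (g : G) (a : X) (f : X -> Y) :
  ball_iso n (g * a : X) f -> ball_iso n a (fun x : X => f (g * x)).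
Proof. exact: (ball_iso_comp (ball_iso_mull n g a)). Qed.

Lemma ball_iso_mull_codom (Y : graph) n (g : G) (a : Y) (f : Y -> X) :
  ball_iso n a f -> ball_iso n a (fun x : Y => g * f x : X).
Proof. by move=> fi; apply: (ball_iso_comp fi (ball_iso_mull n g (f a))). Qed.

(** Balls of equal radius are translates of each other, hence finite of the same size, and an
    inclusion between them is an equality. *)
Lemma cball_cayley_eq n (a b : X) : cball n a `<=` cball n b -> cball n b `<=` cball n a.
Proof.
move=> ab x bx.
have [|y z _ _ /mulgI //|y by_ <-] :=
  finite_inj_surj (g := fun y : X => a * b^-1 * y : X) (finite_cball n b) _ _ bx.
  move=> y /(cball_mull (a * b^-1)); rewrite mulgVK; exact: ab.
by have := cball_mull (a * b^-1) by_; rewrite mulgVK.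
Qed.

(** Let [h] be the local model at [f b], moved to [b]. The lift of [f] through [h] is an
    automorphism of a smaller ball about [b], and near [b] it agrees with a global automorphism
    [g']. So [h \o g'] agrees with [f] near [b] and has the full radius again, which is why
    replacements can be iterated without loss. *)
Lemma cayley_ball_iso_extension (k M : nat) :
  exists2 r, (k < r)%N & forall Y : graph,
    (forall y : Y, exists2 f : X -> Y, ball_iso r (1 : X) f & f 1 = y) -> forall (a b : X) (f : X -> Y), ball_iso r a f -> cball M a b ->
      exists2 g : X -> Y, ball_iso r b g & forall x, cball k b x -> g x = f x.
Proof.
have [r0 r0P] := ball_iso_compactness (1 : X) k.
(* Recentering from [a] to [b] costs [M] and leaves radius [r]: at least [r0] for compactness, and
   more than [k]. *)
pose r := maxn r0 k.+1; exists (M + r)%N.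
  by rewrite (leq_trans _ (leq_addl _ _)) // leq_maxr.
move=> Y loc a b f fi Mab.
have [f1 f1i f1E] := loc (f b).
pose h (x : X) : Y := f1 (b^-1 * x).
have hi : ball_iso (M + r)%N b h.
  by apply: ball_iso_mull_dom; rewrite mulVg.
have fbr : ball_iso r b f by apply: ball_iso_shrink fi Mab _.
have hbr : ball_iso r b h.
  exact: ball_iso_mono (leq_addl _ _) hi.
have fhb : f b = h b by rewrite /h mulVg.
have [al [alb ali alE]] := ball_iso_lift fbr hbr fhb.
(* Conjugation by [b] moves the lift to the vertex 1, where the bound [r0] was obtained; [g'] undoes
   it. *)
pose be (x : X) : X := b^-1 * al (b * x).
have be1 : be 1 = 1 by rewrite /be mulg1 alb mulVg.
have bei : ball_iso r0 (1 : X) be.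
  apply: ball_iso_mull_codom; apply: ball_iso_mull_dom; rewrite mulg1.
  exact: ball_iso_mono (leq_maxl _ _) ali.
have [g [g1 gi gE]] := r0P be be1 bei.
pose g' (x : X) : X := b * g (b^-1 * x).
have g'b : g' b = b by rewrite /g' mulVg g1 mulg1.
have g'i : ball_iso (M + r)%N b g'.
  by apply: ball_iso_mull_codom; apply: ball_iso_mull_dom; rewrite mulVg.
exists (h \o g').
  have := ball_iso_comp g'i; rewrite g'b. exact.
move=> x kx /=; have kx1 := (cball_cayleyE k b x).1 kx.
rewrite /g' gE // /be !mulVKg alE //.
by apply: cball_mono kx; rewrite ltnW // leq_maxr.
Qed.

End CayleyTranslations.

Section Words.
Local Open Scope group_scope.
Variable G : groupType.
Implicit Types (w : seq (G * bool)) (a : G * bool).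

Lemma word_val_nil : word_val ([::] : seq (G * bool)) = 1.
Proof. by rewrite /word_val big_nil. Qed.

Lemma word_val_rcons w a : word_val (rcons w a) = word_val w * letter_val a.
Proof. by rewrite /word_val -cats1 big_cat big_seq1. Qed.

Lemma reduced_rcons w a b :
  reduced (rcons (rcons w b) a) =
  reduced (rcons w b) && ~~ ((b.1 == a.1) && (b.2 != a.2)).
Proof.
rewrite /reduced; case: w => [|c w] /=; first by rewrite andbT.
by rewrite rcons_path last_rcons.
Qed.

Lemma reduced_take w a : reduced (rcons w a) -> reduced w.
Proof. by case/lastP: w => [//|w b]; rewrite reduced_rcons => /andP[]. Qed.

Lemma letter_val_opp a b : a.1 = b.1 -> a.2 != b.2 -> letter_val a = (letter_val b)^-1.
Proof.
rewrite /letter_val => ->; case: a.2; case: b.2 => //= _; by rewrite invgK.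
Qed.

End Words.

(** * Ball isomorphisms indexed by a free subgroup of finite index *)

Section VirtuallyFreeGluing.
Local Open Scope group_scope.
Variables (G : groupType) (S : set G) (hS : finite_symmetric_generating S).
Let X := cayley_graph hS.
Variables H B : set G.
Hypotheses (H_subgroup : is_subgroup H) (H_index : finite_index H) (H_free : free_on H B).

(** [c x] is a representative of the right coset of [x]. It depends on the coset alone, so
    [x * (c x)^-1] is an [H]-component of [x] that commutes with left translation by [H]. *)
Lemma finite_transversal : exists2 c : G -> G, finite_set (range c) &
  (forall x, H (x * (c x)^-1)) /\ (forall h x, H h -> c (h * x) = c x).
Proof.
have [H1 HM HV] := H_subgroup.
have /choice[rep repP] : forall C : set G, exists g, C !=set0 -> C g.
  move=> C; have [[g Cg]|] := pselect (C !=set0); first by exists g.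
  by exists 1.
pose co g := [set h * g | h in H]; exists (rep \o co).
  apply: sub_finite_set (finite_image rep H_index) => _ [g _ <-].
  by exists (co g) => //; exists g.
split=> [x|h x Hh] /=.
  have [|h Hh <-] := repP (co x); first by exists (1 * x), 1.
  by rewrite invgM mulVKg; apply: HV.
congr rep; apply/seteqP; split=> _ [h' Hh' <-].
  by exists (h' * h); rewrite ?mulgA //; apply: HM.
by exists (h' * h^-1); rewrite ?mulgA ?mulgVK //; apply: HM => //; apply: HV.
Qed.

Let letters_in (w : seq (G * bool)) := forall a, a \in w -> B a.1.

Lemma reduced_word_exists : exists rw : G -> seq (G * bool),
  (forall h, H h -> [/\ letters_in (rw h), reduced (rw h) & word_val (rw h) = h]) /\
  (forall w, letters_in w -> reduced w -> rw (word_val w) = w).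
Proof.
have [BH wH] := H_free; have [H1 HM HV] := H_subgroup.
have /choice[rw rwP] : forall h, exists w, H h ->
    [/\ letters_in w, reduced w & word_val w = h].
  move=> h; have [/wH[w [wP _]]|nHh] := pselect (H h); first by exists w.
  by exists [::].
exists rw; split=> // w wB wr.
have Hw : H (word_val w).
  elim/last_ind: w wB {wr} => [|w a IHw] wB; first by rewrite word_val_nil.
  rewrite word_val_rcons; apply: HM.
    by apply: IHw => b bw; apply: wB; rewrite mem_rcons inE bw orbT.
  have Ba : H a.1 by apply/BH/wB; rewrite mem_rcons mem_head.
  by rewrite /letter_val; case: a.2 => //; apply: HV.
have [u [_ uU]] := wH _ Hw.
by rewrite -(uU _ (rwP _ Hw)); apply: uU.
Qed.

Lemma virtually_free_covering : exists r, forall Y : graph,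
  (forall y : Y, exists2 f : X -> Y, ball_iso r (1 : X) f & f 1 = y) -> covered_by Y X.
Proof.
have [H1 HM HV] := H_subgroup; have [BH _] := H_free.
have [c cfin [cH cM]] := finite_transversal.
have [rw [rwP rwU]] := reduced_word_exists.
pose hd x := x * (c x)^-1.
have hdM h x : H h -> hd (h * x) = h * hd x by move=> Hh; rewrite /hd cM // mulgA.
(* Up to left translation by [H], every edge starts at a representative; [U] holds these
   representatives and their neighbours. *)
pose U := range c `|` \bigcup_(x in range c) [set y : X | adj (x : X) y].
have Ufin : finite_set U.
  rewrite finite_setU; split=> //; apply: bigcup_finite => // x _.
  exact: (@graph_locally_finite X).
(* The path of prefixes leading from 1 to [hd u] stays within [n] of [u] and moves by steps of
   length at most [n]. Finiteness of [U] gives a common bound [k]. *)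
pose good u n := (forall i, cball n (word_val (take i (rw (hd u))) : X) (u : X)) /\
  forall a, a \in rw (hd u) -> cball n (1 : X) (letter_val a : X).
have [k kU] : exists k, forall u, U u -> good u k.
  apply: finite_uniform_bound => //.
    move=> u m n mn [g1 g2]; split=> [i|a /g2].
      by apply: cball_mono mn _.
    exact: cball_mono mn.
  move=> u _.
  have [n1 n1P] : exists n, forall i, (i <= size (rw (hd u)))%N ->
      cball n (word_val (take i (rw (hd u))) : X) (u : X).
    elim: (size _) => [|m [n nP]].
      have [n nP] := cball_exhaust (word_val (take 0 (rw (hd u))) : X) (u : X).
      by exists n => i; rewrite leqn0 => /eqP->.
    have [n' n'P] := cball_exhaust (word_val (take m.+1 (rw (hd u))) : X) (u : X).
    exists (maxn n n') => i; rewrite leq_eqVlt => /orP[/eqP->|im].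
      exact: cball_mono (leq_maxr _ _) n'P.
    exact: cball_mono (leq_maxl _ _) (nP _ im).
  have [n2 n2P] : exists n, forall a, a \in rw (hd u) ->
      cball n (1 : X) (letter_val a : X).
    elim: (rw (hd u)) => [|a w [n nP]]; first by exists 0%N.
    have [n' n'P] := cball_exhaust (1 : X) (letter_val a : X).
    exists (maxn n n') => b; rewrite inE => /orP[/eqP->|bw].
      exact: cball_mono (leq_maxr _ _) n'P.
    exact: cball_mono (leq_maxl _ _) (nP _ bw).
  exists (maxn n1 n2); split=> [i|a aw]; last first.
    exact: cball_mono (leq_maxr _ _) (n2P _ aw).
  have [il|li] := leqP i (size (rw (hd u))).
    exact: cball_mono (leq_maxl _ _) (n1P _ il).
  have := n1P _ (leqnn _); rewrite take_size take_oversize ?(ltnW li) //.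
  exact: cball_mono (leq_maxl _ _).
have [r kr rP] := cayley_ball_iso_extension hS k k.
exists r => // Y loc; have {}rP := rP Y loc.
have fi0 (b : X) : exists g : X -> Y, ball_iso r b g.
  have [y0 _] := graph_nonempty Y; have [f fi _] := loc y0.
  by exists (fun x : X => f (b^-1 * x)); apply: ball_iso_mull_dom; rewrite mulVg.
(* A fixed choice of replacement of [f] at [a] by a ball isomorphism at [b]. Outside the range of
   the extension lemma it is an arbitrary ball isomorphism at [b], so [pick] always returns one. *)
have /choice[pick pickP] : forall t : (X -> Y) * X * X, exists g : X -> Y,
    ball_iso r t.2 g /\ (ball_iso r t.1.2 t.1.1 -> cball k t.1.2 t.2 ->
      forall x, cball k t.2 x -> g x = t.1.1 x).
  move=> [[f a] b] /=; have [[fi ab]|N] := pselect (ball_iso r a f /\ cball k a b).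
    by have [g gi gE] := rP a b f fi ab; exists g.
  by have [g gi] := fi0 b; exists g; split=> // fi ab; case: N.
have [f0 f0i] := fi0 1.
(* Words are stored reversed, so the recursion removes the last letter: the map at a word is picked
   from the map at its longest proper prefix. *)
pose Phi := fix Phi (l : seq (G * bool)) : X -> Y :=
  if l is a :: l' then pick (Phi l', word_val (rev l') : X, word_val (rev l) : X) else f0.
have Phi_iso l : ball_iso r (word_val (rev l) : X) (Phi l).
  by case: l => [|a l]; [rewrite word_val_nil|
    exact: (pickP (Phi l, word_val (rev l) : X, word_val (rev (a :: l)) : X)).1].
pose phi (h : G) : X -> Y := Phi (rev (rw h)).
have phi_iso h : H h -> ball_iso r (h : X) (phi h).
  by move=> /rwP[_ _ e]; have := Phi_iso (rev (rw h)); rewrite revK e.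
have H_letter a : B a.1 -> H (letter_val a).
  by rewrite /letter_val => /BH Ha; case: a.2 => //; apply: HV.
have phi_child h a : H h -> B a.1 -> cball k (1 : X) (letter_val a : X) ->
    reduced (rcons (rw h) a) -> forall x : X, cball k (h * letter_val a : X) x ->
    phi (h * letter_val a) x = phi h x.
  move=> Hh Ba ka ra x kx; have [wB wr wv] := rwP h Hh.
  have e : rw (h * letter_val a) = rcons (rw h) a.
    rewrite -{1}wv -word_val_rcons rwU // => b.
    by rewrite mem_rcons inE => /orP[/eqP->|/wB].
  rewrite /phi e rev_rcons /=; apply: (pickP _).2 => /=.
  - exact: Phi_iso.
  - rewrite rev_cons revK word_val_rcons wv.
    by have := cball_mull h ka; rewrite mulg1.
  - by rewrite rev_cons revK word_val_rcons wv.
(* Either [a] lengthens the reduced word of [h], or it cancels its last letter [b], and then [h] is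
   itself the child of [h * letter_val a] along [b]. This is where the tree structure of reduced
   words enters. *)
have phi_step h a : H h -> B a.1 -> cball k (1 : X) (letter_val a : X) ->
    forall x : X, cball k (h : X) x -> cball k (h * letter_val a : X) x ->
    phi (h * letter_val a) x = phi h x.
  move=> Hh Ba ka x kx kx'; have [ra|] := boolP (reduced (rcons (rw h) a)).
    exact: phi_child.
  have [wB wr wv] := rwP h Hh; case/lastP E: (rw h) => [//|w b].
  rewrite reduced_rcons -E wr /= negbK => /andP[/eqP ba1 ba2].
  have lab : letter_val b = (letter_val a)^-1 by apply: letter_val_opp.
  have hb : h = h * letter_val a * letter_val b by rewrite lab mulgK.
  have rwh : rw (h * letter_val a) = w.
    rewrite -{1}wv E word_val_rcons lab mulgVK rwU //.
      by move=> d dw; apply: wB; rewrite E mem_rcons inE dw orbT.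
    by apply: (@reduced_take _ _ b); rewrite -E.
  have kb : cball k (1 : X) (letter_val b : X).
    apply: cball_sym; rewrite lab; have := cball_mull (letter_val a)^-1 ka.
    by rewrite mulg1 mulVg.
  rewrite {2}hb; apply/esym; apply: phi_child => //; rewrite -?hb //.
  - by apply: HM => //; apply: H_letter.
  - by rewrite ba1.
  - by rewrite rwh -E.
(* Walk from [h] to [h * hd u] letter by letter. By the choice of [k], the point [h * u] lies in
   every ball on which consecutive maps agree, so its image never changes. *)
have phi_path h u : H h -> U u -> phi (h * hd u) (h * u) = phi h (h * u).
  move=> Hh Uu; have [g1 g2] := kU u Uu; have [wB _ wv] := rwP (hd u) (cH u).
  suff P i : phi (h * word_val (take i (rw (hd u)))) (h * u) = phi h (h * u) /\
      H (word_val (take i (rw (hd u)))).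
    by have [] := P (size (rw (hd u))); rewrite take_size wv.
  elim: i => [|i [<- Hi]]; first by rewrite take0 word_val_nil mulg1.
  have [si|is_] := leqP (size (rw (hd u))) i.
    by rewrite !take_oversize ?(leqW si) //; rewrite take_oversize // in Hi.
  have aw := mem_nth (1, true) is_.
  set a := nth _ _ _ in aw; have Ba := wB _ aw.
  have te : word_val (take i.+1 (rw (hd u))) =
      word_val (take i (rw (hd u))) * letter_val a.
    by rewrite (take_nth (1, true)) // word_val_rcons.
  split; last by rewrite te; apply: HM => //; apply: H_letter.
  rewrite te mulgA; apply: phi_step => //.
  - exact: HM.
  - exact: g2.
  - exact: (cball_mull h (g1 i)).
  - by rewrite -mulgA -te; apply: (cball_mull h (g1 i.+1)).
pose f (x : X) : Y := phi (hd x) x.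
have fE (h : G) (u : X) : H h -> U u -> f (h * u) = phi h (h * u).
  by move=> Hh Uu; rewrite /f hdM // phi_path.
have hdc x : hd x * c x = x by rewrite /hd mulgVK.
(* On the neighbours of [x], [f] coincides with the single map [phi (hd x)], because
   [(hd x)^-1 * x'] belongs to [U]. Local bijectivity is then inherited from that ball
   isomorphism. *)
have fx' (x x' : X) : adj x x' -> f x' = phi (hd x) x'.
  move=> xx'; have e : x' = hd x * ((hd x)^-1 * x') by rewrite mulVKg.
  rewrite e fE //; first exact: cH.
  have cx' : adj (c x : X) ((hd x)^-1 * x' : X).
    by rewrite -(adj_mull (hd x)) hdc mulVKg.
  by right; exists (c x).
(* The empty prefix in [good] bounds the distance from 1 to [c x]; the strict inequality [k < r]
   then leaves room for the neighbours of [x]. *)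
have kx (x : X) : cball k (hd x : X) x.
  have [g1 _] := kU (c x) (or_introl (ex_intro2 _ _ x I erefl)).
  have := cball_mull (hd x) (g1 0%N).
  by rewrite take0 word_val_nil mulg1 hdc.
exists f; apply: local_iso_covering.
- move=> x x' xx'; rewrite (fx' x x' xx'); have [_ S'] := phi_iso _ (cH x).
  exact: (S' k x kr (kx x)).1.
- move=> x x1 x2 xx1 xx2; rewrite (fx' x x1) // (fx' x x2) //.
  have [inj _] := phi_iso _ (cH x); apply: inj; apply/mem_set.
    exact: cball_mono kr (cball_step (kx x) xx1).
  exact: cball_mono kr (cball_step (kx x) xx2).
- move=> x y fxy; have [_ S'] := phi_iso _ (cH x).
  have [x' xx' <-] := (S' k x kr (kx x)).2 y fxy.
  by exists x' => //; apply: fx'.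
Qed.

End VirtuallyFreeGluing.

(** * Lengths of paths in a graph *)

Local Open Scope ring_scope.

Local Ltac minmax_lra :=
  repeat match goal with
  | |- context [Num.min ?x ?y] => case: (leP x y) => ?
  | |- context [Num.max ?x ?y] => case: (leP x y) => ?
  end; (try (apply/andP; split)); lra.

Section Paths.
Variables (R : realType) (X : graph).
Implicit Types (u v w : X) (s t L : R) (p q : X -> R) (B : set (X -> R)).

Local Notation vpt := (@vpoint R X).

Lemma vpointE u w : vpt u w = (`[< w = u >])%:R.
Proof. by []. Qed.

Lemma vpoint_same u : vpt u u = 1.
Proof. by rewrite vpointE asboolT. Qed.

Lemma vpoint_diff u w : w <> u -> vpt u w = 0.
Proof. by move=> wu; rewrite vpointE asboolF. Qed.

Lemma vpoint_inj u v : vpt u = vpt v -> u = v.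
Proof.
move=> e; apply: contrapT => uv; have := congr1 (fun p => p u) e.
by rewrite vpoint_same vpoint_diff // => /eqP; rewrite oner_eq0.
Qed.

Lemma epoint0 u v : epoint u v 0 = vpt u.
Proof. by apply/funext => w; rewrite /epoint subr0 mul1r mul0r addr0. Qed.

Lemma epoint1 u v : epoint u v 1 = vpt v.
Proof. by apply/funext => w; rewrite /epoint subrr mul1r mul0r add0r. Qed.

Lemma epoint_rev u v t : epoint u v t = epoint v u (1 - t).
Proof. by apply/funext => w; rewrite /epoint subKr addrC. Qed.

Lemma epoint_src u v t : u <> v -> epoint u v t u = 1 - t.
Proof. by move=> uv; rewrite /epoint vpoint_same (vpoint_diff uv) mulr1 mulr0 addr0. Qed.

Lemma epoint_tgt u v t : u <> v -> epoint u v t v = t.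
Proof. by move=> uv; rewrite epoint_rev epoint_src ?subKr //; apply: nesym. Qed.

Lemma epoint_other u v w t : w <> u -> w <> v -> epoint u v t w = 0.
Proof. by move=> wu wv; rewrite /epoint !vpoint_diff // !mulr0 addr0. Qed.

Lemma adj_neq u v : adj u v -> u <> v.
Proof. by move=> /[swap] -> ; rewrite adj_irr. Qed.

Lemma realization_vpoint u : realization (vpt u).
Proof. by left; exists u. Qed.

Lemma realization_epoint u v t : adj u v -> 0 <= t <= 1 -> realization (epoint u v t).
Proof. by move=> uv t01; right; exists u, v, t. Qed.

(** A positive barycentric coordinate at [u] places [p] in the open star of [u]. *)
Lemma realization_star p u : realization p -> 0 < p u ->
  p = vpt u \/ exists v t, [/\ adj u v, 0 <= t < 1 & p = epoint u v t].
Proof.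
case=> [[v ->]|[a [b [t [ab /andP[t0 t1] ->]]]]].
  by rewrite vpointE; case: asboolP => [->|_]; [left|rewrite ltxx].
have anb := adj_neq ab.
have [->|ua] := pselect (u = a).
  by rewrite epoint_src // => t1'; right; exists b, t; split=> //; apply/andP; split=> //; lra.
have [->|ub] := pselect (u = b).
  rewrite epoint_tgt // => t0'; right; exists a, (1 - t).
  by rewrite adj_sym ab -epoint_rev; split=> //; apply/andP; split; lra.
by rewrite epoint_other // ltxx.
Qed.

Lemma realization_edge p u v : u <> v -> realization p -> 0 < p u -> 0 < p v ->
  exists2 t, adj u v /\ 0 < t < 1 & p = epoint u v t.
Proof.
move=> uv rp pu pv; have [e|[w [t [uw /andP[t0 t1] e]]]] := realization_star rp pu.
  by move: pv; rewrite e vpoint_diff ?ltxx //; apply: nesym.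
have uNw := adj_neq uw.
have [vw|vw] := pselect (v = w); last first.
  by move: pv; rewrite e epoint_other ?ltxx //; apply: nesym.
rewrite -vw in e uw uNw.
exists t => //; split=> //.
by move: pv; rewrite e epoint_tgt // => ->.
Qed.

Lemma plpath_ge0 B p q L : plpath B p q L -> 0 <= L.
Proof. by elim=> // *; apply: addr_ge0. Qed.

Lemma plpath_cat B p q r L M : plpath B p q L -> plpath B q r M -> plpath B p r (L + M).
Proof.
move=> pq qr; elim: pq qr => [*|u v s t r' L' uv s01 t01 sB _ IH /IH ?].
  by rewrite add0r.
by rewrite -addrA; apply: plpath_cons.
Qed.

Lemma plpath_segment B u v s t : adj u v -> 0 <= s <= 1 -> 0 <= t <= 1 ->
  (forall r, Num.min s t <= r <= Num.max s t -> B (epoint u v r)) ->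
  plpath B (epoint u v s) (epoint u v t) `|s - t|.
Proof.
move=> uv s01 t01 sB; rewrite -[`|_|]addr0; apply: plpath_cons => //.
by apply: plpath_nil; apply: sB; rewrite ge_min le_max lexx !orbT.
Qed.

Lemma plpath_rev B p q L : plpath B p q L -> plpath B q p L.
Proof.
elim=> [*|u v s t r L' uv s01 t01 sB _ IH]; first exact: plpath_nil.
rewrite addrC distrC; apply: plpath_cat IH _; apply: plpath_segment => // x.
by rewrite minC maxC; apply: sB.
Qed.

(** Test functions for lower bounds: such a function varies by at most the length of any path, so
    each one bounds intrinsic distances from below. *)
Definition edge_lipschitz (F : (X -> R) -> R) := forall u v s t,
  adj u v -> 0 <= s <= 1 -> 0 <= t <= 1 ->
  `|F (epoint u v s) - F (epoint u v t)| <= `|s - t|.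

Lemma plpath_lipschitz B p q L F : edge_lipschitz F -> plpath B p q L -> `|F p - F q| <= L.
Proof.
move=> FL; elim=> [*|u v s t r L' uv s01 t01 sB _ IH]; first by rewrite subrr normr0.
by apply: le_trans (ler_distD (F (epoint u v t)) _ _) (lerD (FL _ _ _ _ uv s01 t01) IH).
Qed.

Lemma intrinsic_dist_le B p q L : plpath B p q L -> intrinsic_dist B p q <= L.
Proof.
move=> pq; apply: ge_inf => //; exists 0 => M; exact: plpath_ge0.
Qed.

(** The given path ensures that the infimum is taken over a nonempty set. *)
Lemma le_intrinsic_dist B p q L c : plpath B p q L ->
  (forall M, plpath B p q M -> c <= M) -> c <= intrinsic_dist B p q.
Proof. by move=> pq cM; apply: lb_le_inf; [exists L|move=> M /cM]. Qed.

Lemma edge_lipschitz_sym (F : (X -> R) -> R) :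
  (forall u v s t, adj u v -> 0 <= s -> s <= t -> t <= 1 ->
    `|F (epoint u v s) - F (epoint u v t)| <= t - s) -> edge_lipschitz F.
Proof.
move=> FL u v s t uv /andP[s0 s1] /andP[t0 t1].
have [st|ts] := leP s t; first by rewrite distrC (distrC s) (ger0_norm (x := t - s)) ?subr_ge0 // distrC FL.
by rewrite distrC (ger0_norm (x := s - t)) ?subr_ge0 ?(ltW ts) // FL // ltW.
Qed.

(* Distinguishes the two ends of a path of length [a + b] through the vertex
   where both coordinates vanish; at most one of the two terms varies along an edge. *)
Lemma edge_lipschitz_clip w1 w2 (a b : R) : w1 <> w2 -> 0 <= a -> 0 <= b -> a + b <= 1 ->
  edge_lipschitz (fun p => Num.min (p w1) a - Num.min (p w2) b).
Proof.
move=> w12 a0 b0 ab1; apply: edge_lipschitz_sym => u v s t uv s0 st t1.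
have uNv := adj_neq uv; rewrite /epoint /vpoint.
case: (asboolP (w1 = u)) => w1u; case: (asboolP (w2 = u)) => w2u; try congruence;
case: (asboolP (w1 = v)) => w1v; case: (asboolP (w2 = v)) => w2v; try congruence;
rewrite ?(mulr1, mulr0, addr0, add0r) ler_norml; minmax_lra.
Qed.

Lemma edge_lipschitz_coord w : edge_lipschitz (fun p => p w).
Proof.
apply: edge_lipschitz_sym => u v s t uv s0 st t1; have uNv := adj_neq uv.
rewrite /epoint /vpoint.
case: (asboolP (w = u)) => wu; case: (asboolP (w = v)) => wv; try congruence;
rewrite ?(mulr1, mulr0, addr0, add0r) ler_norml; minmax_lra.
Qed.

(** No edge joins [w1] to [w2], so when they differ at most one coordinate varies along an edge.
    Evaluated at the two vertices, the function puts them at distance at least 2. *)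
Lemma edge_lipschitz_nonadj w1 w2 : ~~ adj w1 w2 ->
  edge_lipschitz (fun p => p w1 - p w2).
Proof.
move=> w12; apply: edge_lipschitz_sym => u v s t uv s0 st t1; have uNv := adj_neq uv.
have N1 : ~ (w1 = u /\ w2 = v) by move=> [e1 e2]; rewrite e1 e2 uv in w12.
have N2 : ~ (w1 = v /\ w2 = u) by move=> [e1 e2]; rewrite e1 e2 adj_sym uv in w12.
rewrite /epoint /vpoint.
case: (asboolP (w1 = u)) => w1u; case: (asboolP (w2 = u)) => w2u;
case: (asboolP (w1 = v)) => w1v; case: (asboolP (w2 = v)) => w2v; try congruence;
  try (by case: N1); try (by case: N2);
rewrite ?(mulr1, mulr0, addr0, add0r) ler_norml; minmax_lra.
Qed.

(* A point inside the edge [ab] is farther than 1 from every vertex [w] off that edge. *)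
Lemma edge_lipschitz_off w a b : w <> a -> w <> b -> a <> b ->
  edge_lipschitz (fun p => Num.min (p a) (p b) - p w).
Proof.
move=> wa wb ab; apply: edge_lipschitz_sym => u v s t uv s0 st t1.
have uNv := adj_neq uv; rewrite /epoint /vpoint.
case: (asboolP (w = u)) => wu; case: (asboolP (w = v)) => wv; try congruence;
case: (asboolP (a = u)) => au; case: (asboolP (a = v)) => av; try congruence;
case: (asboolP (b = u)) => bu; case: (asboolP (b = v)) => bv; try congruence;
rewrite ?(mulr1, mulr0, addr0, add0r) ler_norml; minmax_lra.
Qed.

(** A point has several encodings as [epoint u v t]; the value is independent of the encoding
    because it is the barycentric sum of [p w * h w]. *)
Lemma affine_extension (h : X -> R) : exists F : (X -> R) -> R,
  forall u v t, F (epoint u v t) = (1 - t) * h u + t * h v.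
Proof.
have vsum (l : seq {classic X}) (u : X) : uniq l -> (u : {classic X}) \in l ->
    \sum_(w <- l) vpt u w * h w = h u.
  move=> lU ul; rewrite (bigD1_seq (u : {classic X})) //= vpoint_same mul1r.
  rewrite big1 ?addr0 // => w /eqP wu.
  by rewrite vpoint_diff // mul0r.
have esum (l : seq {classic X}) (u v : X) t : uniq l ->
    (u : {classic X}) \in l -> (v : {classic X}) \in l ->
    \sum_(w <- l) epoint u v t w * h w = (1 - t) * h u + t * h v.
  move=> lU ul vl; rewrite /epoint.
  under eq_bigr do rewrite mulrDl -!mulrA.
  by rewrite big_split -!mulr_sumr /= !vsum.
have /choice[F FP] : forall p, exists z, forall u v t, p = epoint u v t ->
    z = (1 - t) * h u + t * h v.
  move=> p; have [[u [v [t ->]]]|N] := pselect (exists u v t, p = epoint u v t); last first.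
    by exists 0 => u v t e; case: N; exists u, v, t.
  exists ((1 - t) * h u + t * h v) => u' v' t' e.
  (* The list contains the endpoints of both encodings, so both values are the same sum over it. *)
  pose l : seq {classic X} := undup [:: u : {classic X}; v; u'; v'].
  by rewrite -(esum l) ?e ?(esum l) ?undup_uniq // mem_undup !inE eqxx ?orbT.
by exists F => u v t; apply: FP.
Qed.

Lemma affine_extension_vpoint (h : X -> R) F :
  (forall u v t, F (epoint u v t) = (1 - t) * h u + t * h v) -> forall u, F (vpt u) = h u.
Proof. by move=> FE u; rewrite -(epoint0 u u) FE subr0 mul1r mul0r addr0. Qed.

Lemma edge_lipschitz_affine (h : X -> R) F :
  (forall u v, adj u v -> `|h u - h v| <= 1) ->
  (forall u v t, F (epoint u v t) = (1 - t) * h u + t * h v) -> edge_lipschitz F.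
Proof.
move=> h1 FE u v s t uv _ _; rewrite !FE.
rewrite (_ : _ - _ = (s - t) * (h v - h u)); last by ring.
by rewrite normrM ler_piMr // distrC h1.
Qed.

End Paths.

(** * Balls of half-integer radius *)

Section HalfIntegerBalls.
Variables (R : realType) (X : graph).
Implicit Types (u v w x : X) (s t L : R) (p q : X -> R).

Local Notation vpt := (@vpoint R X).

(* At a half-integer radius a ball contains all the half-edges at its vertices,
   and meets every edge in a segment. *)
Definition hball (n : nat) (x : X) : set (X -> R) := closed_ball x (n%:R + 2^-1).

Definition hdist (n : nat) (x : X) : (X -> R) -> (X -> R) -> R :=
  intrinsic_dist (hball n x).

(** [h] is the combinatorial distance to [x], taken as the least radius of a ball containing the
    vertex. *)
Lemma height_exists x : exists h : X -> nat,
  [/\ h x = 0%N, forall u v, adj u v -> (h v <= (h u).+1)%N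
    & forall n u, cball n x u <-> (h u <= n)%N].
Proof.
have ex u : exists n, `[< cball n x u >].
  by have [n xu] := cball_exhaust x u; exists n; apply/asboolP.
pose h u := ex_minn (ex u).
have hP n u : cball n x u <-> (h u <= n)%N.
  rewrite /h; case: ex_minnP => m /asboolP xu mmin; split.
    by move=> /asboolP; apply: mmin.
  by move=> mn; apply: cball_mono mn xu.
exists h; split=> //; first by apply/eqP; rewrite -leqn0; apply/hP.
by move=> u v uv; apply/hP; apply: cball_step uv; apply/hP.
Qed.

Lemma plpath_cball x n u : cball n x u ->
  exists2 L, plpath (@realization R X) (vpt x) (vpt u) L & L <= n%:R.
Proof.
elim: n u => [|n IHn] u.
  by move=> ->; exists 0 => //; apply/plpath_nil/realization_vpoint.
case=> [/IHn[L xL Ln]|[v /IHn[L xL Ln] vu]].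
  by exists L => //; apply: le_trans Ln _; rewrite ler_nat.
exists (L + `|0 - 1|); last by rewrite sub0r normrN normr1 -natr1 lerD.
apply: plpath_cat xL _; rewrite -(epoint0 R v u) -(epoint1 R v u).
apply: plpath_segment => //; rewrite ?lexx ?ler01 // => r.
rewrite min_l ?max_r ?ler01 // => r01; exact: realization_epoint.
Qed.

Lemma geodesic_dist_half_edge n x u v t : cball n x u -> adj u v -> 0 <= t <= 1 ->
  geodesic_dist (vpt x) (epoint u v t) <= n%:R + t.
Proof.
move=> xu uv t01; have [L xL Ln] := plpath_cball xu.
have [t0 t1] := andP t01.
apply: (@le_trans _ _ (L + `|0 - t|)); last by rewrite sub0r normrN ger0_norm ?lerD2r.
apply: intrinsic_dist_le; apply: plpath_cat xL _; rewrite -(epoint0 R u v).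
apply: plpath_segment => //; rewrite ?lexx ?ler01 // => r.
rewrite min_l ?max_r // => /andP[r0 rt]; apply: realization_epoint => //.
by rewrite r0 (le_trans rt).
Qed.

Lemma hball_half_edge n x u v t : cball n x u -> adj u v -> 0 <= t <= 2^-1 ->
  hball n x (epoint u v t).
Proof.
move=> xu uv /andP[t0 t1]; have t01 : 0 <= t <= 1 by apply/andP; split; lra.
split; first exact: realization_epoint.
by apply: le_trans (geodesic_dist_half_edge xu uv t01) _; rewrite lerD2l.
Qed.

Lemma hball_vertex n x u : cball n x u -> hball n x (vpt u).
Proof.
move=> xu; split; first exact: realization_vpoint.
have [L xL Ln] := plpath_cball xu.
by apply: le_trans (intrinsic_dist_le xL) _; lra.
Qed.

Lemma hball_edge_full n x u v t : cball n x u -> cball n x v -> adj u v -> 0 <= t <= 1 ->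
  hball n x (epoint u v t).
Proof.
move=> xu xv uv /andP[t0 t1]; have [t2|t2] := leP t 2^-1.
  by apply: hball_half_edge => //; rewrite t0.
rewrite epoint_rev; apply: hball_half_edge => //; first by rewrite adj_sym.
by apply/andP; split; lra.
Qed.

(** [F] extends the distance to [x] affinely; heights of adjacent vertices differ by at most 1, so
    [F] is a test function, and it vanishes at [x]. *)
Lemma geodesic_dist_ge x p (h : X -> nat) F : h x = 0%N ->
  (forall u v, adj u v -> (h v <= (h u).+1)%N) ->
  (forall u v t, F (epoint u v t) = (1 - t) * (h u)%:R + t * (h v)%:R) ->
  realization p -> F p <= geodesic_dist (vpt x) p.
Proof.
move=> hx h1 FE rp.
have [L xL] : exists L, plpath (@realization R X) (vpt x) p L.
  case: rp => [[u ->]|[u [v [t [uv t01 ->]]]]].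
    by have [n /plpath_cball[L xL _]] := cball_exhaust x u; exists L.
  have [n /plpath_cball[L xL _]] := cball_exhaust x u.
  exists (L + `|0 - t|); apply: plpath_cat xL _; rewrite -(epoint0 R u v).
  apply: plpath_segment => //; rewrite ?lexx ?ler01 // => r.
  have [t0 t1] := andP t01; rewrite min_l ?max_r // => /andP[r0 rt].
  by apply: realization_epoint => //; rewrite r0 (le_trans rt).
have FL : edge_lipschitz F.
  apply: (edge_lipschitz_affine (h := fun u => (h u)%:R)) => // u v uv.
  have vu : adj v u by rewrite adj_sym.
  move: (h1 _ _ uv) (h1 _ _ vu); rewrite -!(ler_nat R) -!natr1 => ? ?.
  by rewrite ler_norml; apply/andP; split; lra.
apply: (le_intrinsic_dist xL) => M /(plpath_lipschitz FL).
rewrite (affine_extension_vpoint FE) hx sub0r normrN.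
exact: le_trans (ler_norm _).
Qed.

Lemma vertex_hball n x u : hball n x (vpt u) -> cball n x u.
Proof.
move=> [ru]; have [h [hx h1 hc]] := height_exists x.
have [F FE] := affine_extension (fun u => (h u)%:R : R).
move=> D; have := le_trans (geodesic_dist_ge hx h1 FE ru) D.
rewrite (affine_extension_vpoint FE) => hn; apply/hc.
rewrite leqNgt; apply/negP; rewrite -(ler_nat R) -natr1; lra.
Qed.

Lemma edge_hball n x u v t : adj u v -> 0 <= t <= 1 -> hball n x (epoint u v t) ->
  ~ cball n x v -> cball n x u /\ t <= 2^-1.
Proof.
move=> uv /andP[t0 t1] [re]; have [h [hx h1 hc]] := height_exists x.
have [F FE] := affine_extension (fun u => (h u)%:R : R).
move=> D; have := le_trans (geodesic_dist_ge hx h1 FE re) D; rewrite FE => hn Nv.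
(* With height at least [n + 1] at [v] and at least [n] at [u], the function is at least [n + t],
   forcing [t] to be at most 1/2; height [n + 1] at both ends would exceed the radius. *)
have hv : (n.+1 <= h v)%N by rewrite ltnNge; apply/negP => /hc.
have hu : (n <= h u)%N by rewrite -ltnS; apply: leq_trans hv (h1 _ _ uv).
have {}hv : n%:R + 1 <= (h v)%:R :> R by rewrite natr1 ler_nat.
have Pv : 0 <= t * ((h v)%:R - (n%:R + 1)) by apply: mulr_ge0; lra.
have Pu (c : R) : c <= (h u)%:R -> 0 <= (1 - t) * ((h u)%:R - c).
  by move=> ?; apply: mulr_ge0; lra.
split.
  apply/hc; rewrite leqNgt; apply/negP; rewrite -(ler_nat R) -natr1 => /Pu; lra.
have : n%:R <= (h u)%:R :> R by rewrite ler_nat.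
by move=> /Pu; lra.
Qed.

Lemma hball_edge_cases n x u v t : adj u v -> 0 <= t <= 1 -> hball n x (epoint u v t) ->
  [\/ cball n x u /\ cball n x v, [/\ cball n x u, ~ cball n x v & t <= 2^-1]
    | [/\ cball n x v, ~ cball n x u & 2^-1 <= t]].
Proof.
move=> uv t01 xt; have [xv|xv] := pselect (cball n x v); last first.
  by have [] := edge_hball uv t01 xt xv; constructor 2.
have [xu|xu] := pselect (cball n x u); first by constructor 1.
constructor 3; split=> //; rewrite epoint_rev in xt.
have [||_ ?] := edge_hball _ _ xt xu; first by rewrite adj_sym.
  by move/andP: t01 => [? ?]; apply/andP; split; lra.
lra.
Qed.

Lemma hball_convex n x u v s t r : adj u v -> 0 <= s <= 1 -> 0 <= t <= 1 ->
  hball n x (epoint u v s) -> hball n x (epoint u v t) ->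
  Num.min s t <= r <= Num.max s t -> hball n x (epoint u v r).
Proof.
move=> uv s01 t01 xs xt; have [s0 s1] := andP s01; have [t0 t1] := andP t01.
rewrite ge_min le_max => /andP[r1 r2].
have r01 : 0 <= r <= 1.
  by apply/andP; split; [case/orP: r1|case/orP: r2] => ?; lra.
have [r0 r1'] := andP r01.
case: (hball_edge_cases uv s01 xs) => [[xu xv]|[xu xv s2]|[xv xu s2]].
- exact: hball_edge_full.
- case: (hball_edge_cases uv t01 xt) => [[//]|[_ _ t2]|[//]].
  apply: hball_half_edge => //; rewrite r0 /=.
  by case/orP: r2 => ?; lra.
- case: (hball_edge_cases uv t01 xt) => [[//]|[//]|[_ _ t2]].
  rewrite epoint_rev; apply: hball_half_edge => //; first by rewrite adj_sym.
  by apply/andP; split; case/orP: r1 => ?; lra.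
Qed.

Lemma hball_segment n x u v s t : adj u v -> 0 <= s <= 1 -> 0 <= t <= 1 ->
  hball n x (epoint u v s) -> hball n x (epoint u v t) ->
  plpath (hball n x) (epoint u v s) (epoint u v t) `|s - t|.
Proof.
by move=> uv s01 t01 xs xt; apply: plpath_segment => // r; apply: hball_convex.
Qed.

Lemma hdist_edge_le n x u v s t : adj u v -> 0 <= s <= 1 -> 0 <= t <= 1 ->
  hball n x (epoint u v s) -> hball n x (epoint u v t) ->
  hdist n x (epoint u v s) (epoint u v t) <= `|s - t|.
Proof. by move=> *; apply/intrinsic_dist_le/hball_segment. Qed.

Lemma hdist_corner_le n x u v w s t : cball n x u -> adj u v -> adj u w ->
  0 <= s <= 1 -> 0 <= t <= 1 ->
  hball n x (epoint u v s) -> hball n x (epoint u w t) ->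
  hdist n x (epoint u v s) (epoint u w t) <= s + t.
Proof.
move=> xu uv uw s01 t01 xs xt; have [s0 s1] := andP s01; have [t0 t1] := andP t01.
have i01 : 0 <= (0 : R) <= 1 by rewrite lexx ler01.
have -> : s + t = `|s - 0| + `|0 - t| by rewrite subr0 sub0r normrN !ger0_norm.
apply: intrinsic_dist_le; apply: (@plpath_cat _ _ _ _ (vpt u)).
  by rewrite -(epoint0 R u v); apply: hball_segment => //; rewrite epoint0; apply: hball_vertex.
by rewrite -(epoint0 R u w); apply: hball_segment => //; rewrite epoint0; apply: hball_vertex.
Qed.

Lemma hball_near_vertex n x p : hball n x p ->
  exists2 u, cball n x u & p = vpt u \/
    exists v t, [/\ adj u v, 0 < t < 1 & p = epoint u v t].
Proof.
move=> xp; have [rp _] := xp.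
case: rp => [[u e]|[u [v [t [uv t01 e]]]]].
  by exists u; [apply: vertex_hball; rewrite -e|left].
rewrite e in xp; have [t0 t1] := andP t01.
have [e1|t1'] := eqVneq t 1.
  by exists v; [apply: vertex_hball; rewrite -(epoint1 R u v) -e1|left; rewrite e e1 epoint1].
have [e0|t0'] := eqVneq t 0.
  by exists u; [apply: vertex_hball; rewrite -(epoint0 R u v) -e0|left; rewrite e e0 epoint0].
have {}t1' : t < 1 by rewrite lt_neqAle t1'.
have {}t0' : 0 < t by rewrite lt_def t0'.
case: (hball_edge_cases uv t01 xp) => [[xu _]|[xu _ _]|[xv _ _]].
- by exists u => //; right; exists v, t; rewrite t0'.
- by exists u => //; right; exists v, t; rewrite t0'.
- exists v => //; right; exists u, (1 - t); rewrite adj_sym uv -epoint_rev.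
  by split=> //; apply/andP; split; lra.
Qed.

Lemma hball_connected n x p q : hball n x p -> hball n x q ->
  exists L, plpath (hball n x) p q L.
Proof.
suff H p' : hball n x p' -> exists L, plpath (hball n x) (vpt x) p' L.
  move=> /H[L xp] /H[M xq]; exists (L + M).
  exact: plpath_cat (plpath_rev xp) xq.
have i01 : 0 <= (0 : R) <= 1 by rewrite lexx ler01.
have i11 : 0 <= (1 : R) <= 1 by rewrite lexx ler01.
have Hv m u : (m <= n)%N -> cball m x u -> exists L, plpath (hball n x) (vpt x) (vpt u) L.
  elim: m u => [|m IHm] u mn.
    by move=> ->; exists 0; apply/plpath_nil/hball_vertex/cball_center.
  case=> [/(IHm _ (ltnW mn))//|[v xv vu]].
  have [L xL] := IHm v (ltnW mn) xv; exists (L + `|0 - 1|).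
  apply: plpath_cat xL _; rewrite -(epoint0 R v u) -(epoint1 R v u).
  apply: hball_segment => //; rewrite ?epoint0 ?epoint1; apply: hball_vertex.
    exact: cball_mono (ltnW mn) xv.
  by apply: cball_mono mn _; apply: cball_step vu.
move=> xp; have [u xu [e|[v [t [uv /andP[t0 t1] e]]]]] := hball_near_vertex xp.
  by rewrite e; apply: (Hv n).
have [L xL] := Hv n u (leqnn _) xu; exists (L + `|0 - t|); apply: plpath_cat xL _.
rewrite e -(epoint0 R u v); apply: hball_segment => //; rewrite -?e ?epoint0 //.
  by rewrite !ltW.
exact: hball_vertex.
Qed.

Lemma hdist_ge n x p q (F : (X -> R) -> R) : edge_lipschitz F ->
  hball n x p -> hball n x q -> `|F p - F q| <= hdist n x p q.
Proof.
move=> FL xp xq; have [L pq] := hball_connected xp xq.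
by apply: (le_intrinsic_dist pq) => M; apply: plpath_lipschitz.
Qed.

Lemma hdist_self n x p : hball n x p -> hdist n x p p <= 0.
Proof. by move=> xp; apply/intrinsic_dist_le/plpath_nil. Qed.

Lemma hdist_vertices_adj n x u v : hball n x (vpt u) -> hball n x (vpt v) -> u <> v ->
  hdist n x (vpt u) (vpt v) <= 1 -> adj u v.
Proof.
move=> xu xv uv d1; apply/negPn/negP => /edge_lipschitz_nonadj FL.
have := le_trans (hdist_ge (FL R) xu xv) d1; rewrite /= !vpoint_same.
by rewrite !vpoint_diff //; [rewrite ler_norml => /andP[_]; lra|exact: nesym].
Qed.

Lemma hdist_adj_le n x u v : cball n x u -> cball n x v -> adj u v ->
  hdist n x (vpt u) (vpt v) <= 1.
Proof.
move=> xu xv uv.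
have := @hdist_edge_le n x u v 0 1 uv; rewrite sub0r normrN normr1 epoint0 epoint1.
by apply; rewrite ?lexx ?ler01 //; apply: hball_vertex.
Qed.

End HalfIntegerBalls.

(** * Branch points and isometries *)

Section BranchPoints.
Variables (R : realType) (X : graph).
Implicit Types (u v w x : X) (s t : R) (p q : X -> R).

Definition branch_vertex u := exists v1 v2 v3,
  [/\ adj u v1, adj u v2, adj u v3 & [/\ v1 <> v2, v1 <> v3 & v2 <> v3]].

(* Metric form of "at least three edges emanate from [p]". *)
Definition branch_point (B : set (X -> R)) (d : (X -> R) -> (X -> R) -> R) p :=
  forall e : R, 0 < e <= 2^-1 -> exists q1 q2 q3, [/\ B q1, B q2, B q3 &
    [/\ d p q1 = e, d p q2 = e, d p q3 = e,
        d q1 q2 = e + e & d q1 q3 = e + e /\ d q2 q3 = e + e]].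

Lemma hdist_spoke n x u v t : cball n x u -> adj u v -> 0 <= t <= 2^-1 ->
  hdist n x (vpoint R u) (epoint u v t) = t.
Proof.
move=> xu uv /andP[t0 t2]; have uNv := adj_neq uv.
have xt : hball n x (epoint u v t) by apply: hball_half_edge; rewrite ?t0.
have x0 : hball n x (vpoint R u) by apply: hball_vertex.
apply/eqP; rewrite eq_le; apply/andP; split; last first.
  have := hdist_ge (edge_lipschitz_coord v) x0 xt.
  rewrite epoint_tgt // vpoint_diff; last exact: nesym.
  by rewrite sub0r normrN; apply: le_trans; apply: ler_norm.
have := @hdist_edge_le _ _ n x u v 0 t uv.
rewrite epoint0 sub0r normrN ger0_norm //; apply => //.
  by rewrite lexx ler01.
by apply/andP; split; lra.
Qed.

(** The upper bound passes through [u]. The clipped test function excludes a shortcut, even when [v]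
    and [w] are adjacent. *)
Lemma hdist_spokes n x u v w t : cball n x u -> adj u v -> adj u w -> v <> w ->
  0 <= t <= 2^-1 -> hdist n x (epoint u v t) (epoint u w t) = t + t.
Proof.
move=> xu uv uw vw t02; have [t0 t2] := andP t02.
have uNv := adj_neq uv; have uNw := adj_neq uw.
have t01 : 0 <= t <= 1 by apply/andP; split; lra.
have xv : hball n x (epoint u v t) by apply: hball_half_edge.
have xw : hball n x (epoint u w t) by apply: hball_half_edge.
apply/eqP; rewrite eq_le hdist_corner_le //=.
have tt1 : t + t <= 1 by lra.
have := hdist_ge (edge_lipschitz_clip vw t0 t0 tt1) xv xw.
rewrite !epoint_tgt // !epoint_other; try by [|apply: nesym].
rewrite minxx min_l // ler_norml => /andP[]; lra.
Qed.

Lemma branch_vertex_point n x u : cball n x u -> branch_vertex u ->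
  branch_point (hball n x) (hdist n x) (vpoint R u).
Proof.
move=> xu [v1 [v2 [v3 [uv1 uv2 uv3 [v12 v13 v23]]]]] e /andP[e0 e2].
have e02 : 0 <= e <= 2^-1 by rewrite ltW.
exists (epoint u v1 e), (epoint u v2 e), (epoint u v3 e).
by split; try exact: hball_half_edge; split; rewrite ?hdist_spoke ?hdist_spokes.
Qed.

(** The coordinates at [u] and [v] are test functions and stay positive within distance [e], so [q]
    lies on the same edge. Hence only two points have distance [e], one on each side. *)
Lemma hdist_interior n x u v s q e : adj u v -> 0 <= e -> 0 < s - e -> s + e < 1 ->
  hball n x (epoint u v s) -> hball n x q -> hdist n x (epoint u v s) q = e ->
  q = epoint u v (s - e) \/ q = epoint u v (s + e).
Proof.
move=> uv e0 se1 se2 xs xq de; have uNv := adj_neq uv.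
have s01 : 0 <= s <= 1 by apply/andP; split; lra.
have := hdist_ge (edge_lipschitz_coord u) xs xq.
have := hdist_ge (edge_lipschitz_coord v) xs xq.
rewrite de epoint_src // epoint_tgt // !ler_norml => /andP[qv1 qv2] /andP[qu1 qu2].
have [rq _] := xq.
have [||t [_ /andP[t0 t1]] qE] := realization_edge uNv rq.
- by lra.
- by lra.
rewrite qE in qv1 qv2 xq de *; rewrite epoint_tgt // in qv1 qv2.
have t01 : 0 <= t <= 1 by rewrite !ltW.
have := hdist_edge_le uv s01 t01 xs xq; rewrite de.
have [st|ts] := leP s t.
  rewrite distrC ger0_norm ?subr_ge0 // => ?; right; congr epoint; lra.
rewrite ger0_norm => [?|]; last by rewrite subr_ge0 ltW.
by left; congr epoint; lra.
Qed.

Lemma branch_point_vertex n x p : hball n x p ->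
  branch_point (hball n x) (hdist n x) p -> exists2 u, branch_vertex u & p = vpoint R u.
Proof.
move=> xp bp.
have dne q1 q2 (e : R) : 0 < e -> hball n x q1 -> hdist n x q1 q2 = e -> q1 <> q2.
  by move=> e0 xq d12 q12; move: (hdist_self xq); rewrite {2}q12 d12; lra.
have [u xu [e|[v [t [uv /andP[t0 t1] e]]]]] := hball_near_vertex xp.
  rewrite e in xp bp *; exists u => //.
  have [|q1 [q2 [q3 [B1 B2 B3 [d1 d2 d3 d12 [d13 d23]]]]]] := bp 2^-1.
    by apply/andP; split; lra.
  (* At a vertex, points at distance 1/2 are midpoints of edges leaving it; three distinct ones give
     three neighbours. *)
  have spoke q : hball n x q -> hdist n x (vpoint R u) q = 2^-1 ->
      exists2 v, adj u v & q = epoint u v 2^-1.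
    move=> xq dq; have := hdist_ge (edge_lipschitz_coord u) xp xq.
    rewrite dq vpoint_same ler_norml => /andP[_ q2'].
    have [||qE|[v [t [uv /andP[t0 t1] qE]]]] := @realization_star _ _ q u.
    - by have [] := xq.
    - lra.
    - have : hdist n x (vpoint R u) (vpoint R u) <= 0 by apply: hdist_self.
      by rewrite -{2}qE dq; lra.
    - exists v => //; have uNv := adj_neq uv; rewrite qE epoint_src // in q2'.
      rewrite qE in dq xq.
      have := @hdist_edge_le _ _ n x u v 0 t uv.
      rewrite epoint0 dq sub0r normrN ger0_norm // => H.
      have : 2^-1 <= t.
        apply: H => //; first by rewrite lexx ler01.
        by rewrite t0 ltW.
      by move=> ?; rewrite qE; congr epoint; lra.
  have [v1 uv1 e1] := spoke _ B1 d1; have [v2 uv2 e2] := spoke _ B2 d2.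
  have [v3 uv3 e3] := spoke _ B3 d3.
  have pos : (0 : R) < 2^-1 + 2^-1 by lra.
  exists v1, v2, v3; split=> //; split=> v12.
  - by apply: (dne _ _ _ pos B1 d12); rewrite e1 e2 v12.
  - by apply: (dne _ _ _ pos B1 d13); rewrite e1 e3 v12.
  - by apply: (dne _ _ _ pos B2 d23); rewrite e2 e3 v12.
(* Inside an edge, [d] is small enough to stay in the edge in both directions; three distinct points
   cannot share the two positions at distance [d]. *)
rewrite e in xp bp; pose d := Num.min t (1 - t) / 2.
have [d0 dt dt' d2] : [/\ 0 < d, 0 < t - d, t + d < 1 & d <= 2^-1].
  by rewrite /d; case: (leP t (1 - t)) => ?; split; lra.
have d02 : 0 < d <= 2^-1 by rewrite d0.
have [q1 [q2 [q3 [B1 B2 B3 [d1 d2' d3 d12 [d13 d23]]]]]] := bp d d02.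
have pos : 0 < d + d by lra.
have N12 := dne _ _ _ pos B1 d12; have N13 := dne _ _ _ pos B1 d13.
have N23 := dne _ _ _ pos B2 d23.
case: (hdist_interior uv (ltW d0) dt dt' xp B1 d1) => E1;
case: (hdist_interior uv (ltW d0) dt dt' xp B2 d2') => E2;
case: (hdist_interior uv (ltW d0) dt dt' xp B3 d3) => E3; congruence.
Qed.

End BranchPoints.

Lemma isometric_subsets_sym (R : realType) (X Y : graph) (A : set (X -> R)) (B : set (Y -> R)) :
  isometric_subsets A B -> isometric_subsets B A.
Proof.
move=> [f [fA finj fsurj] fd].
have /choice[g gP] : forall q, exists p, B q -> A p /\ f p = q.
  move=> q; have [Bq|NB] := pselect (B q); last by exists (fun=> 0).
  by have [p Ap pq] := fsurj q Bq; exists p.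
have gf p : A p -> g (f p) = p.
  move=> Ap; have [Ag e] := gP _ (fA _ Ap).
  by apply: finj; rewrite ?inE.
exists g; last by move=> p q /gP[Ap ep] /gP[Aq eq]; rewrite -fd // ep eq.
split; first by move=> q /gP[].
- by move=> q1 q2; rewrite !inE => /gP[_ e1] /gP[_ e2] e; rewrite -e1 -e2 e.
- by move=> p Ap; exists (f p); [apply: fA|apply: gf].
Qed.

Section BallIsometries.
Variables (R : realType) (X Y : graph) (n : nat) (x : X) (y : Y).
Implicit Types (f : (X -> R) -> (Y -> R)).

Lemma branch_point_transfer f p :
  set_bij (hball n x) (hball n y) f ->
  (forall p q, hball n x p -> hball n x q -> hdist n y (f p) (f q) = hdist n x p q) ->
  hball n x p -> branch_point (hball n x) (hdist n x) p ->
  branch_point (hball n y) (hdist n y) (f p).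
Proof.
move=> [fA _ _] fd xp bp e /bp[q1 [q2 [q3 [B1 B2 B3 [d1 d2 d3 d12 [d13 d23]]]]]].
by exists (f q1), (f q2), (f q3); rewrite !fd //; split=> //; apply: fA.
Qed.

(** The inverse isometry would carry a branch point at [y] to one in the ball of [X], which must be
    a branch vertex. *)
Lemma isometry_no_branch :
  isometric_subsets (@hball R X n x) (@hball R Y n y) ->
  (forall u : X, ~ branch_vertex u) -> ~ branch_vertex y.
Proof.
move=> iso Nb yb; have yy := hball_vertex R (cball_center n y).
have [g [gA ginj gsurj] gd] := isometric_subsets_sym iso.
have bp : branch_point (hball n x) (hdist n x) (g (vpoint R y)).
  move=> e /(branch_vertex_point (cball_center n y) yb).
  move=> [q1 [q2 [q3 [B1 B2 B3 [d1 d2 d3 d12 [d13 d23]]]]]].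
  by exists (g q1), (g q2), (g q3); rewrite /hdist !gd //; split=> //; apply: gA.
by have [u /Nb] := branch_point_vertex (gA _ yy) bp.
Qed.

(* If every vertex of [X] has degree at least 3, an isometry between balls
   preserves branch points, hence vertices; a vertex of the target is at distance
   less than 1 from the image of a vertex, hence equal to it. *)
Lemma isometry_ball_iso :
  (forall u : X, branch_vertex u) ->
  (forall a b : X, cball n a `<=` cball n b -> cball n b `<=` cball n a) ->
  isometric_subsets (@hball R X n x) (@hball R Y n y) ->
  exists u, exists2 phi : X -> Y, ball_iso n u phi & phi u = y.
Proof.
move=> br homog [f fbij fd']; have [fA finj fsurj] := fbij.
have fd p q : hball n x p -> hball n x q -> hdist n y (f p) (f q) = hdist n x p q.
  exact: fd'.
have /choice[phi phiP] : forall u, exists z, cball n x u -> f (vpoint R u) = vpoint R z.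
  move=> u; have [xu|xu] := pselect (cball n x u); last by exists y.
  have xu' := hball_vertex R xu.
  have [z _ e] := branch_point_vertex (fA _ xu')
    (branch_point_transfer fbij fd xu' (branch_vertex_point xu (br u))).
  by exists z.
have phiC u : cball n x u -> cball n y (phi u).
  by move=> xu; apply: (@vertex_hball R); rewrite -phiP //; apply/fA/hball_vertex.
have phiI u v : cball n x u -> cball n x v -> phi u = phi v -> u = v.
  move=> xu xv e; apply: (@vpoint_inj R); apply: finj.
  - exact/mem_set/hball_vertex.
  - exact/mem_set/hball_vertex.
  - by rewrite !phiP // e.
have phiS z : cball n y z -> exists2 u, cball n x u & phi u = z.
  move=> yz; have [p xp fp] := fsurj _ (hball_vertex R yz).
  have [u xu pE] := hball_near_vertex xp; exists u => //.
  have xu' := hball_vertex R xu.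
  have d1 : hdist n x (vpoint R u) p < 1.
    case: pE => [->|[v [t [uv /andP[t0 t1] pE]]]].
      by apply: le_lt_trans (hdist_self xu') _; rewrite ltr01.
    rewrite pE in xp *; have := @hdist_edge_le _ _ n x u v 0 t uv.
    rewrite epoint0 sub0r normrN gtr0_norm // => H; apply: (le_lt_trans _ t1).
    by apply: H => //; [rewrite lexx ler01|rewrite !ltW].
  apply: contrapT => uz; rewrite -fd // fp phiP // in d1.
  have := hdist_ge (edge_lipschitz_coord z) (hball_vertex R (phiC _ xu)) (hball_vertex R yz).
  rewrite vpoint_same vpoint_diff; last exact: nesym.
  by rewrite sub0r normrN normr1; lra.
have phiA u v : cball n x u -> cball n x v -> adj u v -> adj (phi u) (phi v).
  move=> xu xv uv; apply: (@hdist_vertices_adj R _ n y).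
  - exact/hball_vertex/phiC.
  - exact/hball_vertex/phiC.
  - by move=> /(phiI _ _ xu xv); apply: adj_neq.
  - rewrite -!phiP // fd; try exact: hball_vertex.
    exact: hdist_adj_le.
have phiA' u v : cball n x u -> cball n x v -> adj (phi u) (phi v) -> adj u v.
  move=> xu xv uv; apply: (@hdist_vertices_adj R _ n x).
  - exact/hball_vertex.
  - exact/hball_vertex.
  - by move=> e; apply: (adj_neq uv); rewrite e.
  - rewrite -fd; try exact: hball_vertex.
    by rewrite !phiP //; apply: hdist_adj_le => //; apply: phiC.
have [u xu uy] := phiS y (cball_center n y).
(* The vertex [u] over [y] may differ from the center [x]. Pulling balls about [y] back to [u] puts
   the ball about [x] inside the one about [u], and [homog] reverses the inclusion. *)
have lift j z : (j <= n)%N -> cball j y z -> forall w, cball n x w -> phi w = z -> cball j u w.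
  elim: j z => [|j IHj] z jn.
    by move=> -> w xw wz; apply: phiI => //; rewrite uy.
  case=> [yz|[z' yz' zz]] w xw wz.
    by left; apply: IHj wz => //; apply: ltnW.
  have [w' xw' wz'] := phiS z' (cball_mono (ltnW jn) yz').
  right; exists w'; first exact: IHj (ltnW jn) yz' _ xw' wz'.
  by apply: phiA' => //; rewrite wz wz'.
have sub : cball n u `<=` cball n x.
  apply: homog => w xw; exact: lift (leqnn _) (phiC _ xw) _ xw erefl.
exists u, phi => //; split.
  by move=> v w /set_mem /sub xv /set_mem /sub xw; apply: phiI.
have phij j w : (j <= n)%N -> cball j u w -> cball j y (phi w).
  elim: j w => [|j IHj] w jn; first by move=> ->.
  case=> [uw|[v uv vw]]; first by left; apply: IHj => //; apply: ltnW.
  right; exists (phi v); first by apply: IHj => //; apply: ltnW.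
  apply: phiA => //; apply: sub; first exact: cball_mono (ltnW jn) uv.
  by apply: cball_mono jn _; apply: cball_step vw.
move=> j w jn uw; have xw : cball n x w by apply: sub; apply: cball_mono (ltnW jn) uw.
split=> w' ww'.
  by apply: phiA => //; apply: sub; apply: cball_mono jn _; apply: cball_step ww'.
have [v xv vw'] := phiS w' (cball_mono jn (cball_step (phij j w (ltnW jn) uw) ww')).
by exists v => //; apply: phiA'; rewrite ?vw'.
Qed.

End BallIsometries.

(** * Degrees read off from balls of radius 1/2 *)

Section HalfBalls.
Variables (R : realType) (X Y : graph).

Lemma half_ball_points (y : Y) (q : Y -> R) : hball 0 y q ->
  q = vpoint R y \/ exists w t, [/\ adj y w, 0 <= t <= 2^-1 & q = epoint y w t].
Proof.
move=> yq; have [_ -> [->|[w [t [yw /andP[t0 t1] qE]]]]] := hball_near_vertex yq.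
  by left.
right; exists w, t; split=> //; rewrite qE in yq.
have t01 : 0 <= t <= 1 by rewrite !ltW.
have [|_ t2] := edge_hball yw t01 yq; first by move=> /= e; apply: (adj_neq yw).
by rewrite t2 ltW.
Qed.

Lemma half_ball_degree1 (x v : X) (y : Y) :
  isometric_subsets (@hball R X 0 x) (@hball R Y 0 y) ->
  adj x v -> exists w, adj y w.
Proof.
move=> [f [fA finj _] _] xv; apply: contrapT => N.
have A0 : hball 0 x (vpoint R x) by exact: hball_vertex.
have A1 : hball 0 x (epoint x v (2^-1 : R)).
  by apply: hball_half_edge => //; rewrite lexx invr_ge0 ler0n.
have onlyy q : hball 0 y q -> q = vpoint R y.
  by move=> /half_ball_points[//|[w [t [yw _ _]]]]; case: N; exists w.
have : vpoint R x = epoint x v 2^-1.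
  apply: finj; rewrite ?inE //.
  by rewrite (onlyy _ (fA _ A0)) (onlyy _ (fA _ A1)).
move=> /(congr1 (fun p => p v)); rewrite epoint_tgt; last exact: adj_neq.
by rewrite vpoint_diff; [lra|apply: nesym; apply: adj_neq].
Qed.

(** With a single neighbour, [y] would have a segment of length 1/2 as its ball, too short for two
    midpoints at distance 1. *)
Lemma half_ball_degree2 (x v1 v2 : X) (y : Y) :
  isometric_subsets (@hball R X 0 x) (@hball R Y 0 y) ->
  adj x v1 -> adj x v2 -> v1 <> v2 -> exists w1 w2, [/\ adj y w1, adj y w2 & w1 <> w2].
Proof.
move=> iso xv1 xv2 v12; have [w yw] := half_ball_degree1 iso xv1.
have [f [fA finj _] fd'] := iso; apply: contrapT => N.
have fd p q : hball 0 x p -> hball 0 x q -> hdist 0 y (f p) (f q) = hdist 0 x p q.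
  exact: fd'.
have onlyw w' : adj y w' -> w' = w.
  by move=> yw'; apply: contrapT => ww'; apply: N; exists w', w.
have half : 0 <= (2^-1 : R) <= 2^-1 by rewrite lexx invr_ge0 ler0n.
have A v : adj x v -> hball 0 x (epoint x v (2^-1 : R)) by move=> xv; apply: hball_half_edge.
have pt (q : Y -> R) : hball 0 y q -> exists2 t : R, 0 <= t <= 2^-1 & q = epoint y w t.
  move=> /half_ball_points[->|[w' [t [/onlyw -> t02 ->]]]]; last by exists t.
  by exists 0; rewrite ?epoint0 // lexx invr_ge0 ler0n.
have [t1 t1P e1] := pt _ (fA _ (A _ xv1)); have [t2 t2P e2] := pt _ (fA _ (A _ xv2)).
have := hdist_spokes (cball_center 0 x) xv1 xv2 v12 half.
have B1 := fA _ (A _ xv1); have B2 := fA _ (A _ xv2).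
rewrite -fd; try exact: A.
rewrite e1 e2 in B1 B2 *; move/andP: t1P => [? ?]; move/andP: t2P => [? ?].
have := hdist_edge_le yw _ _ B1 B2 => /[swap] ->.
have t1' : 0 <= t1 <= 1 by apply/andP; split; lra.
have t2' : 0 <= t2 <= 1 by apply/andP; split; lra.
move=> /(_ t1' t2'); rewrite leNgt => /negP; apply.
by rewrite ltr_norml; apply/andP; split; lra.
Qed.

End HalfBalls.

(** * Coverings by a finite cycle *)

Section CycleCovering.
Variables (R : realType) (X Y : graph) (n : nat).

Lemma hdist_sym (Z : graph) m (x : Z) (p q : Z -> R) : hdist m x p q = hdist m x q p.
Proof.
rewrite /hdist /intrinsic_dist; congr inf.
by apply/seteqP; split=> L; apply: plpath_rev.
Qed.

(** An interior point of an edge is closer than 1 to the ends of that edge and farther than 1 from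
    every other vertex. *)
Lemma hdist1_vertex (y z : Y) (q : Y -> R) : hball n y (vpoint R z) -> hball n y q ->
  hdist n y (vpoint R z) q = 1 -> exists2 z', adj z z' & q = vpoint R z'.
Proof.
move=> yz yq d1; have [a ya [qE|[b [s [ab /andP[s0 s1] qE]]]]] := hball_near_vertex yq.
  exists a => //; rewrite qE in d1 yq; apply: (hdist_vertices_adj yz yq).
    by move=> e; move: (hdist_self yz); rewrite {2}e d1 ler10.
  by rewrite d1.
exfalso; have aNb := adj_neq ab; rewrite qE in d1 yq.
have s01 : 0 <= s <= 1 by rewrite !ltW.
have [za|za] := pselect (z = a).
  rewrite za -(epoint0 R a b) in yz d1.
  have := hdist_edge_le ab _ s01 yz yq; rewrite d1 sub0r normrN gtr0_norm //.
  by rewrite lexx ler01 => /(_ isT); lra.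
have [zb|zb] := pselect (z = b).
  rewrite zb -(epoint1 R a b) in yz d1.
  have := hdist_edge_le ab _ s01 yz yq; rewrite d1 gtr0_norm ?subr_gt0 //.
  by rewrite lexx ler01 => /(_ isT); lra.
have := hdist_ge (edge_lipschitz_off za zb aNb) yz yq.
rewrite d1 epoint_src // epoint_tgt // epoint_other // vpoint_same !vpoint_diff; try exact: nesym.
rewrite minxx ler_norml; case: (leP (1 - s) s) => ? /andP[]; lra.
Qed.

Variables (nx pv : X -> X).
Hypotheses (nxA : forall x, adj x (nx x)) (nxK : cancel nx pv) (pvK : cancel pv nx)
  (nx_pv : forall x, nx x <> pv x)
  (nbrs : forall x x', adj x x' -> x' = nx x \/ x' = pv x)
  (whole : forall x u : X, cball n x u).

Lemma cycle_no_branch (x : X) : ~ branch_vertex x.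
Proof.
move=> [v1 [v2 [v3 [/nbrs h1 /nbrs h2 /nbrs h3 [v12 v13 v23]]]]].
by case: h1 => ?; case: h2 => ?; case: h3 => ?; congruence.
Qed.

Lemma cycle_rotation_dist (x0 x : X) (t : R) : 0 <= t <= 1 ->
  hdist n x0 (epoint x (nx x) t) (epoint (nx x) (nx (nx x)) t) = 1.
Proof.
move=> /andP[t0 t1]; have t01 : 0 <= t <= 1 by rewrite t0.
have t01' : 0 <= 1 - t <= 1 by apply/andP; split; lra.
have nnx : nx (nx x) <> x by rewrite -{2}(nxK x); apply: nx_pv.
have A z : hball n x0 (epoint z (nx z) t) by apply: hball_edge_full.
have xn := adj_neq (nxA x); have nn := adj_neq (nxA (nx x)).
apply/eqP; rewrite eq_le; apply/andP; split.
  rewrite (_ : 1 = (1 - t) + t); last by rewrite subrK.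
  move: (A x); rewrite epoint_rev => A'.
  by apply: hdist_corner_le => //; rewrite adj_sym.
have t1' : 0 <= 1 - t by lra.
have tt : t + (1 - t) <= 1 by lra.
(* The path turns at [nx x] after length [1 - t] and continues for [t]; clipping at these two
   lengths makes the test function vary by exactly 1. *)
have := hdist_ge (edge_lipschitz_clip nnx t0 t1' tt) (A x) (A (nx x)).
rewrite epoint_src // epoint_tgt // !epoint_other //; try exact: nesym.
rewrite !minxx !min_l // ler_norml => /andP[]; lra.
Qed.

Lemma cycle_covering :
  (forall y : Y, exists x : X, isometric_subsets (@hball R X n x) (@hball R Y n y)) ->
  covered_by Y X.
Proof.
move=> loc.
have Ynb (y : Y) : ~ branch_vertex y.
  by have [x iso] := loc y; apply: (isometry_no_branch iso cycle_no_branch).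
have [y0 _] := graph_nonempty Y; have [c [f [fA finj fsurj] fd']] := loc y0.
have fd p q : hball n c p -> hball n c q -> hdist n y0 (f p) (f q) = hdist n c p q.
  exact: fd'.
have [p cp fp] := fsurj _ (hball_vertex R (cball_center n y0)).
(* The preimage [p] of [y0] may lie inside an edge. Orienting that edge along [nx] lets the same
   offset [t] be used at every vertex. *)
have [x0 [t [t0 t1 pE]]] : exists x0 (t : R), [/\ 0 <= t, t < 1 & p = epoint x0 (nx x0) t].
  have [u _ [->|[v [t [uv /andP[t0 t1] ->]]]]] := hball_near_vertex cp.
    by exists u, 0; rewrite epoint0 lexx ltr01.
  have [->|vp] := nbrs uv; first by exists u, t; rewrite ltW.
  exists v, (1 - t); rewrite -epoint_rev vp pvK; split=> //; lra.
have t01 : 0 <= t <= 1 by rewrite t0 ltW.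
pose q (x : X) : X -> R := epoint x (nx x) t.
have qB x : hball n c (q x) by apply: hball_edge_full.
(* As [t < 1], [q x] has a positive coordinate at [x]. Equal points with distinct [x] and [x'] would
   make each the [nx] of the other, against [nx_pv]. *)
have qI x x' : q x = q x' -> x = x'.
  move=> e; apply: contrapT => xx'.
  have xN := adj_neq (nxA x); have xN' := adj_neq (nxA x').
  have e1 : q x x = q x' x by rewrite e.
  have e2 : q x x' = q x' x' by rewrite e.
  rewrite /q /= in e1 e2; rewrite epoint_src // in e1; rewrite [RHS]epoint_src // in e2.
  have [h1|h1] := pselect (x = nx x'); last first.
    by rewrite epoint_other // in e1; clear e fp pE; lra.
  have [h2|h2] := pselect (x' = nx x); last first.
    rewrite epoint_other // in e2; last exact: nesym.
    by clear e fp pE; lra.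
  by apply: (@nx_pv x'); rewrite -h1 h2 nxK.
have dq x : hdist n c (q x) (q (nx x)) = 1 by apply: cycle_rotation_dist.
(* Being sent to a vertex spreads around the cycle: consecutive rotated points are at distance 1,
   and a point at distance 1 from a vertex is a vertex. *)
have /choice[phi phiP] : forall x, exists z, f (q x) = vpoint R z.
  apply: (@graph_ind X _ x0); first by exists y0; rewrite /q -pE.
  move=> x x' [z fz] xx'.
  have yz : hball n y0 (vpoint R z) by rewrite -fz; apply: fA.
  have d1 : hdist n y0 (vpoint R z) (f (q x')) = 1.
    rewrite -fz fd //; have [->|->] := nbrs xx'; first exact: dq.
    by rewrite hdist_sym -{2}(pvK x) dq.
  by have [z' _ ->] := hdist1_vertex yz (fA _ (qB x')) d1; exists z'.
have phiA x : adj (phi x) (phi (nx x)).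
  have yz : hball n y0 (vpoint R (phi x)) by rewrite -phiP; apply: fA.
  have d1 : hdist n y0 (vpoint R (phi x)) (f (q (nx x))) = 1.
    by rewrite -phiP fd // -(dq x).
  have [z xz e] := hdist1_vertex yz (fA _ (qB _)) d1.
  by rewrite phiP in e; rewrite (vpoint_inj e).
have phiI x x' : phi x = phi x' -> x = x'.
  move=> e; apply: qI; apply: finj; try exact/mem_set/qB.
  by rewrite !phiP e.
exists phi; apply: local_iso_covering.
- move=> x x' /nbrs[->|->] //; rewrite adj_sym -{2}(pvK x); exact: phiA.
- by move=> x x1 x2 _ _; apply: phiI.
- move=> x y xy.
  have pA : adj (phi x) (phi (pv x)) by rewrite adj_sym -{2}(pvK x).
  have xpv : adj x (pv x) by rewrite adj_sym -{2}(pvK x).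
  have [<-|N1] := pselect (phi (nx x) = y); first by exists (nx x).
  have [<-|N2] := pselect (phi (pv x) = y); first by exists (pv x).
  (* A third neighbour would make [phi x] a branch vertex. *)
  case: (Ynb (phi x)); exists (phi (nx x)), (phi (pv x)), y; split=> //; split=> //.
  by move=> /phiI; apply: nx_pv.
Qed.

End CycleCovering.

(** * Graphs of degree at most 2 *)

Section DegreeTwo.

(** A bi-infinite walk without backtracking; it may repeat vertices, so it parametrizes lines and
    cycles alike. *)
Definition is_walk (X : graph) (a : int -> X) : Prop :=
  (forall i, adj (a i) (a (i + 1))) /\ (forall i, a (i + 2) <> a i).

Definition two_regular (X : graph) : Prop :=
  (forall x : X, exists v1 v2, [/\ adj x v1, adj x v2 & v1 <> v2]) /\
  (forall x : X, ~ branch_vertex x).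

Lemma walk_exists (X : graph) : two_regular X -> exists a : int -> X, is_walk a.
Proof.
move=> [deg2 _].
(* [nb (u, v)] continues the walk past [v] without returning to [u]. *)
have /choice[nb nbP] : forall d : X * X, exists w,
    adj d.1 d.2 -> adj d.2 w /\ w <> d.1.
  move=> [u v] /=; have [v1 [v2 [vv1 vv2 v12]]] := deg2 v.
  have [e|] := pselect (v1 = u); last by exists v1.
  by exists v2 => _; split=> // e'; apply: v12; rewrite e.
pose step (d : X * X) := (d.2, nb d).
have stepA n d : adj d.1 d.2 -> adj (iter n step d).1 (iter n step d).2.
  by move=> dA; elim: n => //= n /nbP[].
have iterA n d : adj d.1 d.2 -> adj (iter n step d).1 (iter n.+1 step d).1.
  by move=> /(stepA n).
have iter2 n d : adj d.1 d.2 -> (iter n.+2 step d).1 <> (iter n step d).1.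
  by move=> /(stepA n) /= /nbP[].
have [x0 _] := graph_nonempty X; have [x1 [_ [x01 _ _]]] := deg2 x0.
have x10 : adj x1 x0 by rewrite adj_sym.
(* The negative half is the walk started along the reversed edge, whose position [m] receives index
   [1 - m]; thus [Negz n], that is [1 - (n + 2)], gets position [n + 2]. *)
pose a (i : int) := match i with
  | Posz n => (iter n step (x0, x1)).1 | Negz n => (iter n.+2 step (x1, x0)).1 end.
have aN n : a (1 - n%:Z) = (iter n step (x1, x0)).1.
  case: n => [|[|n]] //.
  by rewrite (_ : 1 - n.+2%:Z = Negz n) // NegzE; lia.
exists a; split=> -[n|n].
- by rewrite (_ : Posz n + 1 = Posz n.+1); [apply: (iterA n (x0, x1))|lia].
- rewrite (_ : Negz n + 1 = 1 - n.+1%:Z); last by rewrite NegzE; lia.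
  rewrite (_ : Negz n = 1 - n.+2%:Z); last by rewrite NegzE; lia.
  by rewrite !aN adj_sym; apply: (iterA n.+1 (x1, x0)).
- by rewrite (_ : Posz n + 2 = Posz n.+2); [apply: (iter2 n (x0, x1))|lia].
- rewrite (_ : Negz n + 2 = 1 - n%:Z); last by rewrite NegzE; lia.
  rewrite (_ : Negz n = 1 - n.+2%:Z); last by rewrite NegzE; lia.
  by rewrite !aN; apply: nesym; apply: (iter2 n (x1, x0)).
Qed.

Section Walks.
Variable X : graph.
Hypothesis X_unbranched : forall x : X, ~ branch_vertex x.
Implicit Types a b : int -> X.

Lemma walk_shift a c : is_walk a -> is_walk (fun i => a (c + i)).
Proof. by move=> [a1 a2]; split=> i; rewrite addrA. Qed.

Lemma walk_rev a c : is_walk a -> is_walk (fun i => a (c - i)).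
Proof.
move=> [a1 a2]; split=> i.
  by rewrite adj_sym; have := a1 (c - (i + 1)); rewrite (_ : c - (i + 1) + 1 = c - i) //; lia.
apply: nesym; have := a2 (c - (i + 2)); rewrite (_ : c - (i + 2) + 2 = c - i) //; lia.
Qed.

Lemma walk_nbrs a i x : is_walk a -> adj (a i) x -> x = a (i + 1) \/ x = a (i - 1).
Proof.
move=> [a1 a2] ix; apply: contrapT => N; apply: (X_unbranched (x := a i)).
exists x, (a (i + 1)), (a (i - 1)); split=> //.
  by rewrite adj_sym; have := a1 (i - 1); rewrite subrK.
split; try by move=> e; apply: N; [left|right].
  by move=> e; apply: N; left.
  by move=> e; apply: N; right.
by have := a2 (i - 1); rewrite (_ : i - 1 + 2 = i + 1) //; lia.
Qed.

(** Each vertex has only its two walk neighbours, and backtracking is excluded, so two consecutive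
    values force the next. Reversal about 1 exchanges the initial values and handles negative
    indices. *)
Lemma walk_det a b : is_walk a -> is_walk b -> a 0 = b 0 -> a 1 = b 1 -> a =1 b.
Proof.
have det_nat a' b' : is_walk a' -> is_walk b' -> a' 0 = b' 0 -> a' 1 = b' 1 ->
    forall n : nat, a' n%:Z = b' n%:Z.
  move=> wa wb e0 e1 n; suff [] : a' n%:Z = b' n%:Z /\ a' (n%:Z + 1) = b' (n%:Z + 1) by [].
  elim: n => [//|n [IH0 IH1]].
  have nE : n.+1%:Z = n%:Z + 1 by lia.
  rewrite nE; split=> //.
  have := wa.1 (n%:Z + 1); rewrite {1}IH1 => /(walk_nbrs wb)[//|].
  rewrite addrK -IH0; case: wa => _ /(_ n%:Z); rewrite (_ : n%:Z + 1 + 1 = n%:Z + 2) //; lia.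
move=> wa wb e0 e1 [n|n]; first exact: det_nat.
have := det_nat _ _ (walk_rev 1 wa) (walk_rev 1 wb).
rewrite subr0 subrr => /(_ e1 e0 n.+2).
by rewrite (_ : 1 - n.+2%:Z = Negz n) // NegzE; lia.
Qed.

Lemma walk_periodic a i j : is_walk a -> a i = a j -> forall l, a (i + l) = a (j + l).
Proof.
move=> wa ij; have := wa.1 i; rewrite {1}ij => /(walk_nbrs wa)[e|e].
  by apply: walk_det; rewrite ?addr0 //; apply: walk_shift.
have refl : (fun l => a (i + l)) =1 (fun l => a (j - l)).
  by apply: walk_det; rewrite ?addr0 ?subr0 //; [apply: walk_shift|apply: walk_rev].
(* A repetition in the opposite direction would be a reflection of the walk: centered at an index it
   backtracks, centered between two indices it gives a loop. *)
have [c [jE|jE]] : exists c : int, j = i + c + c \/ j = i + c + c + 1.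
  exists ((j - i) %/ 2)%Z; have := divz_eq (j - i) 2.
  have := ltz_pmod (j - i) (isT : 0 < 2 :> int); have := modz_ge0 (j - i) (isT : 2 != 0 :> int).
  by lia.
- case: (wa.2 (i + (c - 1))); rewrite (refl (c - 1)); congr a; lia.
- have := wa.1 (i + c); rewrite {1}(refl c) => /adj_neq[]; congr a; lia.
Qed.

Lemma walk_surj a : is_walk a -> forall x, exists i, a i = x.
Proof.
move=> wa; apply: (graph_ind (a := a 0)); first by exists 0.
by move=> _ x [i <-] /(walk_nbrs wa)[->|->]; [exists (i + 1)|exists (i - 1)].
Qed.

(** A repeated value makes the walk periodic, and since the walk visits every vertex, [X] would be
    finite. *)
Lemma walk_inj a : is_walk a -> infinite_set [set: X] -> injective a.
Proof.
move=> wa Xinf i j ij; apply: contrapT => iNj; apply: Xinf.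
have per l : a (l + (j - i)) = a l.
  rewrite -[RHS](_ : a (i + (l - i)) = _); last by congr a; lia.
  by rewrite (walk_periodic wa ij); congr a; lia.
have perN l (n : nat) : a (l + n%:Z * (j - i)) = a l.
  elim: n l => [|n IHn] l; first by rewrite mul0r addr0.
  by rewrite -[RHS](IHn l) -[RHS]per; congr a; lia.
have perZ l (k : int) : a (l + k * (j - i)) = a l.
  case: k => n; first exact: perN.
  by rewrite -(perN _ n.+1) NegzE; congr a; lia.
have d0 : j - i != 0 by apply/eqP; lia.
apply: (@sub_finite_set _ _ [set a k%:Z | k in `I_(`|j - i|)%N]); last first.
  exact/finite_image/finite_II.
move=> x _; have [k <-] := walk_surj wa x.
exists `|(k %% (j - i))%Z|%N.
  rewrite /= -ltz_nat gez0_abs ?modz_ge0 //; exact: ltz_mod.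
rewrite gez0_abs ?modz_ge0 //.
by have := perZ (k %% (j - i))%Z (k %/ (j - i))%Z; rewrite addrC -divz_eq.
Qed.

End Walks.

(** The walk in [X] is a bijection from the integers; follow its inverse by a walk in [Y]. *)
Lemma line_covering (X Y : graph) :
  two_regular X -> two_regular Y -> infinite_set [set: X] -> covered_by Y X.
Proof.
move=> X2 Y2 Xinf; have [a wa] := walk_exists X2; have [b wb] := walk_exists Y2.
have ainj := walk_inj X2.2 wa Xinf.
have /choice[idx idxK] := walk_surj X2.2 wa.
have aK i : idx (a i) = i by apply: ainj; apply: idxK.
have bprev i : adj (b i) (b (i - 1)).
  by rewrite adj_sym; have := wb.1 (i - 1); rewrite subrK.
have b2 i : b (i + 1) <> b (i - 1).
  by have := wb.2 (i - 1); rewrite (_ : i - 1 + 2 = i + 1) //; lia.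
exists (b \o idx); apply: local_iso_covering => x.
- move=> x'; rewrite -{1}(idxK x) /= => /(walk_nbrs X2.2 wa)[->|->]; rewrite aK //.
  exact: wb.1.
- move=> x1 x2; rewrite -{1 2}(idxK x).
  move=> /(walk_nbrs X2.2 wa)[->|->] /(walk_nbrs X2.2 wa)[->|->] //=; rewrite !aK.
    by move/b2.
  by move/esym/b2.
- move=> y /= /(walk_nbrs Y2.2 wb)[->|->].
    by exists (a (idx x + 1)); rewrite ?aK //; rewrite -{1}(idxK x); apply: wa.1.
  exists (a (idx x - 1)); rewrite ?aK // adj_sym -{2}(idxK x).
  by have := wa.1 (idx x - 1); rewrite subrK.
Qed.

(** [nx] and [pv] shift along a walk. On a cycle the index of a vertex is not unique, and
    [walk_periodic] makes the shift independent of it. *)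
Lemma two_regular_rotation (X : graph) : two_regular X -> exists nx pv : X -> X,
  [/\ forall x, adj x (nx x), cancel nx pv, cancel pv nx, forall x, nx x <> pv x
    & forall x x', adj x x' -> x' = nx x \/ x' = pv x].
Proof.
move=> X2; have [a wa] := walk_exists X2.
have /choice[idx idxK] := walk_surj X2.2 wa.
pose sh k x := a (idx x + k).
have shE k i : sh k (a i) = a (i + k) by apply: (walk_periodic X2.2) => //; apply: idxK.
exists (sh 1), (sh (-1)); split=> x.
- by rewrite -{1}(idxK x); apply: wa.1.
- by rewrite /sh -/(sh (-1) _) shE addrK.
- by rewrite /sh -/(sh 1 _) shE subrK.
- by have := wa.2 (idx x - 1); rewrite /sh (_ : idx x - 1 + 2 = idx x + 1) //; lia.
- by move=> x'; rewrite -{1}(idxK x) => /(walk_nbrs X2.2 wa).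
Qed.

End DegreeTwo.

Section DegreeAtMostOne.

(** By connectedness [X] is a single vertex or a single edge, and the last hypothesis decides the
    same alternative for [Y]. *)
Lemma degree_le1_covering (X Y : graph) :
  (forall x v1 v2 : X, adj x v1 -> adj x v2 -> v1 = v2) ->
  (forall y w1 w2 : Y, adj y w1 -> adj y w2 -> w1 = w2) ->
  (forall (x : X) (y : Y), (exists v, adj x v) <-> (exists w, adj y w)) ->
  covered_by Y X.
Proof.
move=> X1 Y1 XY; have [x0 _] := graph_nonempty X; have [y0 _] := graph_nonempty Y.
have [[x1 x01]|N] := pselect (exists v, adj x0 v); last first.
  have Xx0 x : x = x0.
    move: x; apply: (graph_ind (a := x0)) => // _ x -> x0x.
    by case: N; exists x.
  exists (fun=> y0); apply: local_iso_covering.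
  - by move=> x x'; rewrite (Xx0 x) => xx'; case: N; exists x'.
  - by move=> x x1 x2; rewrite (Xx0 x) => xx'; case: N; exists x1.
  - by move=> x y yy; case: N; apply/(XY x0 y0); exists y.
have [y1 y01] : exists w, adj y0 w by apply/(XY x0 y0); exists x1.
have x10 : adj x1 x0 by rewrite adj_sym.
have y10 : adj y1 y0 by rewrite adj_sym.
have Xx x : x = x0 \/ x = x1.
  move: x; apply: (graph_ind (a := x0)); first by left.
  by move=> _ x [->|->] xx; [right; apply: X1 x01|left; apply: X1 x10].
pose f x := if `[< x = x0 >] then y0 else y1.
have f0 : f x0 = y0 by rewrite /f asboolT.
have f1 : f x1 = y1.
  by rewrite /f asboolF // => e; move: x01; rewrite e adj_irr.
exists f; apply: local_iso_covering.
- move=> x x'; have [->|->] := Xx x.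
    by move=> /(X1 _ _ _ x01) <-; rewrite f0 f1.
  by move=> /(X1 _ _ _ x10) <-; rewrite f0 f1.
- by move=> x v1 v2 /X1 h /h.
- move=> x y; have [->|->] := Xx x; rewrite ?f0 ?f1.
    by move=> /(Y1 _ _ _ y01) <-; exists x1.
  by move=> /(Y1 _ _ _ y10) <-; exists x0.
Qed.

End DegreeAtMostOne.

(** * Vertex-transitivity and the case distinction on the degree *)

Section CayleyDegrees.
Local Open Scope group_scope.
Variables (G : groupType) (S : set G) (hS : finite_symmetric_generating S).
Let X := cayley_graph hS.

Lemma adj_translate (u u' v : X) : adj u v -> adj u' (u' * (u^-1 * v) : X).
Proof. by rewrite -(adj_mull (u' * u^-1)) mulgVK mulgA. Qed.

Lemma translate_inj (u u' : X) : injective (fun v : X => u' * (u^-1 * v) : X).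
Proof. by move=> v w /mulgI /mulgI. Qed.

Lemma branch_vertex_cayley (u u' : X) : branch_vertex u -> branch_vertex u'.
Proof.
move=> [v1 [v2 [v3 [a1 a2 a3 [v12 v13 v23]]]]].
exists (u' * (u^-1 * v1)), (u' * (u^-1 * v2)), (u' * (u^-1 * v3)).
split; try exact: adj_translate.
by split=> /translate_inj.
Qed.

End CayleyDegrees.

Theorem corollary4 (R : realType) (G : groupType)
    (G_fg : finitely_generated G) (G_vfree : virtually_free G)
    (S : set G) (hS : finite_symmetric_generating S) :
  LG_rigid R (cayley_graph hS).
Proof.
set X := cayley_graph hS.
have pos n : (0 < n%:R + 2^-1 :> R)%R by rewrite ltr_wpDl ?ler0n ?invr_gt0 ?ltr0n.
(* By transitivity the degree at 1 decides the case: at least 3, exactly 2, or at most 1. *)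
have [br1|Nbr1] := pselect (branch_vertex (1%g : X)).
  have br (u : X) : branch_vertex u by apply: branch_vertex_cayley br1.
  have [H [Hsub Hind [B Hfree]]] := G_vfree.
  have [r rP] := virtually_free_covering hS Hsub Hind Hfree.
  exists (r%:R + 2^-1)%R => // Y loc; apply: rP => y.
  have [x iso] := loc y.
  have [u [phi phii phiu]] := isometry_ball_iso br (@cball_cayley_eq _ _ hS r) iso.
  exists (fun z : X => phi (u * z)%g); last by rewrite mulg1.
  by apply: ball_iso_mull_dom; rewrite mulg1.
have Nbr (u : X) : ~ branch_vertex u by move=> /(branch_vertex_cayley 1%g).
have [[v1 [v2 [a1 a2 v12]]]|N2] :=
    pselect (exists v1 v2 : X, [/\ adj (1%g : X) v1, adj (1%g : X) v2 & v1 <> v2]).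
  have X2 : two_regular X.
    split=> // x; exists (x * (1^-1 * v1))%g, (x * (1^-1 * v2))%g.
    by split; [exact: adj_translate|exact: adj_translate|move=> /translate_inj].
  have [Xfin|Xinf] := pselect (finite_set [set: X]).
    (* For a cycle, the radius is chosen so that every ball is the whole graph. *)
    have [n nP] : exists n, forall u : X, [set: X] u -> cball n (1%g : X) u.
      apply: finite_uniform_bound => //; first by move=> a m n; apply: cball_mono.
      by move=> a _; apply: cball_exhaust.
    have whole (x u : X) : cball n x u by apply/cball_cayleyE/nP.
    have [nx [pv [nxA nxK pvK nx_pv nbrs]]] := two_regular_rotation X2.
    exists (n%:R + 2^-1)%R => // Y loc.
    exact: (cycle_covering nxA nxK pvK nx_pv nbrs whole loc).
  exists (0%:R + 2^-1)%R => // Y loc; apply: line_covering => //.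
  split=> y; have [x iso] := loc y; last exact: isometry_no_branch iso Nbr.
  have [w1 [w2 [xw1 xw2 w12]]] := X2.1 x.
  exact: half_ball_degree2 iso xw1 xw2 w12.
have X1 (x v1 v2 : X) : adj x v1 -> adj x v2 -> v1 = v2.
  move=> xv1 xv2; apply: contrapT => v12; apply: N2.
  exists (1 * (x^-1 * v1))%g, (1 * (x^-1 * v2))%g.
  by split; [exact: adj_translate|exact: adj_translate|move=> /translate_inj].
exists (0%:R + 2^-1)%R => // Y loc; apply: degree_le1_covering => //.
  move=> y w1 w2 yw1 yw2; apply: contrapT => w12.
  have [x /isometric_subsets_sym iso] := loc y.
  have [v1 [v2 [xv1 xv2]]] := half_ball_degree2 iso yw1 yw2 w12.
  by apply; apply: X1 xv1 xv2.
move=> x y; have [z iso] := loc y; split=> [[v xv]|[w yw]].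
  exact: half_ball_degree1 iso (adj_translate z xv).
have [v zv] := half_ball_degree1 (isometric_subsets_sym iso) yw.
by exists (x * (z^-1 * v))%g; apply: adj_translate.
Qed.
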